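(* Let $b\in\{0,1,\dots,p-1\}$. For $z\in\mathbb C\setminus\text{bands}$, $$\lim_{m\to\infty}z^{-mp/2}\,\Gamma_+(z)^{-m}\,\varphi_{mp+b}(z)=j_b(z),\qquad j_b(z):=a(z)\varphi_b(z)+b(z)\psi_b(z).$$ In addition, $j_b$ is nonvanishing near $z=\infty$ (i.e. for all $|z|$ sufficiently large). In particular, if $z_0\notin\text{bands}$ and $j_b(z_0)\ne0$, then for some $\varepsilon>0$ and $M$ we have $\varphi_{mp+b}(z)\ne0$ if $|z-z_0|<\varepsilon$ and $m\ge M$. If $z_0\notin\text{bands}$ and $j_b$ has a zero of order $k$ at $z_0$, then for some $\varepsilon>0$ and all $m$ large, $\varphi_{mp+b}$ has precisely $k$ zeros (counting multiplicity) in $|z-z_0|<\varepsilon$. The number of $z_0$ in $\mathbb C\setminus\text{bands}$ with $j_b(z_0)=0$ is at most $2p+2b-1$.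
   Context: Let $p\ge2$ be even and let $\{\alpha_n\}_{n\ge0}$ be complex numbers with $|\alpha_n|<1$ and $\alpha_{n+p}=\alpha_n$; put $\rho_n=(1-|\alpha_n|^2)^{1/2}$. The orthonormal polynomials on the unit circle are defined by $\varphi_0\equiv1$, $\varphi_{n+1}(z)=\rho_n^{-1}(z\varphi_n(z)-\bar\alpha_n\varphi_n^*(z))$, where $\varphi_n^*(z)=z^n\overline{\varphi_n(1/\bar z)}$. The second kind polynomials $\psi_n$ are defined in the same way with $\{\alpha_n\}$ replaced by $\{-\alpha_n\}$. Let $A_k(z)=\frac1{\rho_k}\begin{pmatrix}z&-\bar\alpha_k\\-z\alpha_k&1\end{pmatrix}$, $T_n(z)=A_{n-1}(z)\cdots A_0(z)$, $\Delta(z)=z^{-p/2}\mathrm{Tr}(T_p(z))$. The function $\Delta$ is real on the unit circle $\partial\mathbb D$, and $\{z:\Delta(z)\in(-2,2)\}$ consists of $p$ disjoint open arcs of $\partial\mathbb D$; the bands are the closures of these arcs, and $\mathbb C\setminus\text{bands}$ is the complement of their union. The matrix $z^{-p/2}T_p(z)$ has determinant $1$ and eigenvalues $\Gamma_\pm(z)=\frac{\Delta(z)}2\pm\sqrt{(\Delta(z)/2)^2-1}$, labelled on $\mathbb C\setminus\text{bands}$ so that $|\Gamma_+(z)|>|\Gamma_-(z)|$. Put $P_+(z)=\dfrac{z^{-p/2}T_p(z)-\Gamma_-(z)\mathbf 1}{\Gamma_+(z)-\Gamma_-(z)}$, and $$a(z)=\tfrac12\Bigl\langle\tbinom11,P_+(z)\tbinom11\Bigr\rangle,\qquad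 b(z)=\tfrac12\Bigl\langle\tbinom1{-1},P_+(z)\tbinom11\Bigr\rangle,$$ with $\langle\cdot,\cdot\rangle$ the standard inner product on $\mathbb C^2$. (The function $b(z)$ is not to be confused with the integer $b$.) At $z=0$ the functions $z^{p/2}\Gamma_\pm(z)$ and $P_+(z)$, hence $a,b,j_b$, are understood by analytic continuation (removable singularity).
   Formalization: The bound 2p+2b-1 on the number of zeros of j_b is stated assuming some α_n ≠ 0; if all α_n = 0 it is false, since then j_b vanishes identically on the open unit disc, which lies outside the bands. *)

(* Defs.v *)
From mathcomp Require Import all_boot all_order all_algebra.
From mathcomp Require Import all_classical all_reals all_analysis.
From mathcomp Require Import complex.

Set Implicit Arguments.
Unset Strict Implicit.
Unset Printing Implicit Defensive.

Import Order.TTheory GRing.Theory Num.Theory.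
Import numFieldNormedType.Exports.

Local Open Scope classical_set_scope.
Local Open Scope ring_scope.

(* The complex numbers over R, packed as a numClosedFieldType so that the
   topology that MathComp-Analysis puts on every numFieldType is inferred. *)
Definition cplx (R : realType) : numClosedFieldType := R[i].

Section OPUC.
Variable C : numClosedFieldType.
Implicit Types (alpha : nat -> C) (q : {poly C}) (z : C) (n p b k : nat).

(* The operation q |-> q^* in degree n, i.e. z^n * conj (q (1 / conj z)) as a
   polynomial in z; see star_polyE. *)
Definition star_poly n q : {poly C} := \poly_(i < n.+1) (q`_(n - i))^*.

Lemma star_polyE n q z : (size q <= n.+1)%N -> z != 0 ->
  (star_poly n q).[z] = z ^+ n * (q.[(z^*)^-1])^*.
Proof.
move=> sq z0; rewrite (horner_coef_wide _ sq) horner_poly rmorph_sum mulr_sumr.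
rewrite (reindex_inj rev_ord_inj) /=; apply: eq_bigr => i _.
rewrite subSS subKn -1?ltnS // rmorphM rmorphXn /= fmorphV /= conjCK mulrCA.
have le_in : (i <= n)%N by rewrite -ltnS.
rewrite -[X in z ^+ X * z^-1 ^+ i](subnK le_in) exprD exprVn mulfK //.
by rewrite expf_neq0.
Qed.

Definition rho alpha n : C := sqrtC (1 - `|alpha n| ^+ 2).

Fixpoint phi alpha n : {poly C} :=
  if n is m.+1 then
    (rho alpha m)^-1 *:
      ('X * phi alpha m - (alpha m)^* *: star_poly m (phi alpha m))
  else 1.

Definition psi alpha n : {poly C} := phi (fun k => - alpha k) n.

Definition col2 (u v : C) : 'cV[C]_2 := \col_i [:: u; v]`_i.

Definition mx2 (u v w t : C) : 'M[C]_2 :=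
  \matrix_(i, j) (nth [::] [:: [:: u; v]; [:: w; t]] i)`_j.

Definition inner (u v : 'cV[C]_2) : C := \sum_i (u i 0)^* * v i 0.

Definition transfer1 alpha k z : 'M[C]_2 :=
  (rho alpha k)^-1 *: mx2 z (- (alpha k)^*) (- (z * alpha k)) 1.

Fixpoint transfer alpha n z : 'M[C]_2 :=
  if n is m.+1 then transfer1 alpha m z *m transfer alpha m z else 1%:M.

(* For z != 0; the value at z = 0 (a pole) is junk and never used.  The same
   applies to Gamma_plus, Gamma_minus and Pplus0. *)
Definition Delta alpha p z : C := z ^- p./2 * \tr (transfer alpha p z).

(* The order of C makes -2 < w < 2 mean that w is real and lies in (-2, 2).
   The set is a finite union of arcs, so its closure is the union of the
   closures of these arcs. *)
Definition bands alpha p : set C :=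
  closure [set z | z != 0 /\ - 2 < Delta alpha p z < 2].

Definition eigen1 alpha p z : C :=
  Delta alpha p z / 2 + sqrtC ((Delta alpha p z / 2) ^+ 2 - 1).

Definition eigen2 alpha p z : C :=
  Delta alpha p z / 2 - sqrtC ((Delta alpha p z / 2) ^+ 2 - 1).

Definition Gamma_plus alpha p z : C :=
  if `|eigen2 alpha p z| < `|eigen1 alpha p z| then eigen1 alpha p z
  else eigen2 alpha p z.

Definition Gamma_minus alpha p z : C :=
  if `|eigen2 alpha p z| < `|eigen1 alpha p z| then eigen2 alpha p z
  else eigen1 alpha p z.

(* The continuation of f across a removable singularity at 0. *)
Definition ext0 (f : C -> C) z : C :=
  if z == 0 then lim (f w @[w --> (0 : C)^']) else f z.

Definition Pplus0 alpha p z : 'M[C]_2 :=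
  (Gamma_plus alpha p z - Gamma_minus alpha p z)^-1 *:
    (z ^- p./2 *: transfer alpha p z - (Gamma_minus alpha p z)%:M).

Definition Pplus alpha p z : 'M[C]_2 :=
  \matrix_(i, j) ext0 (fun w => Pplus0 alpha p w i j) z.

Definition a_fun alpha p z : C :=
  2^-1 * inner (col2 1 1) (Pplus alpha p z *m col2 1 1).

Definition b_fun alpha p z : C :=
  2^-1 * inner (col2 1 (-1)) (Pplus alpha p z *m col2 1 1).

Definition j_fun alpha p b z : C :=
  a_fun alpha p z * (phi alpha b).[z] + b_fun alpha p z * (psi alpha b).[z].

(* z^(-mp/2) Gamma_+(z)^(-m), continued to z = 0 like z^(p/2) Gamma_+(z). *)
Definition prefactor alpha p m z : C :=
  ext0 (fun w => w ^- (m * p)./2 * Gamma_plus alpha p w ^- m) z.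

Definition zero_of_order (f : C -> C) z0 k : Prop :=
  (0 < k)%N /\
  exists g : C -> C,
    [/\ \forall z \near z0, derivable g z 1,
        g z0 != 0
      & \forall z \near z0, f z = (z - z0) ^+ k * g z].

(* The zeros of a nonzero polynomial, repeated according to multiplicity. *)
Definition zeros q : seq C := sval (closed_field_poly_normal q).

End OPUC.

(* Main.v *)
Require Import Defs.
From mathcomp Require Import all_boot all_order all_algebra.
From mathcomp Require Import all_classical all_reals all_analysis.
From mathcomp Require Import complex ring zify.
Set Implicit Arguments.
Unset Strict Implicit.
Unset Printing Implicit Defensive.
Import Order.TTheory GRing.Theory Num.Theory.
Import numFieldNormedType.Exports.
Local Open Scope classical_set_scope.
Local Open Scope card_scope.
Local Open Scope ring_scope.

(** The sequence [phi alpha (m * p + b)], [m] varying, is a component of the powers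
    of the transfer matrix T over one period, so at each point [z] it satisfies
    the linear recurrence whose characteristic roots are the eigenvalues [lambda1]
    and [lambda2] of T ([phi_rec]). Off the bands their moduli differ
    ([off_bands_split]): equal moduli mean Delta in [-2, 2], and the
    points where Delta is 2 or -2 are limits of points of the open bands. The
    larger eigenvalue then wins, which is the limit ([cvg_phi_normalized]), with
    the explicit formula ([j_funE], where l1, l2 stand for [lambda1], [lambda2])
    j = (phi_(b+p) - l2 phi_b) / (l1 - l2).

    At infinity l2 stays bounded, so phi_(b+p) dominates the numerator and j does
    not vanish ([j_fun_infinity]). In general a zero of j off the bands makes
    phi_(b+p) / phi_b an eigenvalue of T, hence is a root of
    phi_(b+p)^2 - tr T phi_(b+p) phi_b + z^p phi_b^2. The terms of degree 2p + 2b
    cancel, and this polynomial is nonzero unless all coefficients alpha vanish: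
    it factors into two determinants, one expressing that (1,1) is an
    eigenvector, the other that an off-diagonal entry of a shifted T is zero
    ([eliminant_factor], [eliminant_neq0]). This bounds the number of zeros
    ([card_zeros_j_fun]).

    The zeros of the orthonormal polynomials near a point off the bands are
    counted by Hurwitz's argument without contour integrals. Both
    sides of the comparison can be taken polynomial: powers of l1 are replaced by
    the Lucas polynomials (l1^m - l2^m) / (l1 - l2), which do not vanish near the
    point for large m ([zeros_phi_near]). What remains is Rouche's theorem
    for polynomials ([rouche_factored]). It is obtained from Jensen's formula,
    itself read off from products over the N-th roots of unity: comparing
    two polynomials on a circle compares their Mahler measures ([mahler_le]), and
    the growth of the Mahler measure across an annulus counts the roots inside
    ([mahler_scale4]). *)

(** * Powers in an archimedean field *)

Section PowerGrowth.
Variable C : numClosedFieldType.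
Hypothesis archi : forall x : C, exists n : nat, `|x| < n%:R.
Implicit Types x y e : C.

Lemma bernoulli x n : 0 <= x -> 1 + x *+ n <= (1 + x) ^+ n.
Proof.
move=> x0; elim: n => [|n IH]; first by rewrite mulr0n addr0 expr0.
rewrite exprS; apply: le_trans (_ : (1 + x) * (1 + x *+ n) <= _); last first.
  by rewrite ler_wpM2l // addr_ge0.
have -> : (1 + x) * (1 + x *+ n) = 1 + x *+ n.+1 + x * (x *+ n).
  by rewrite mulrS; ring.
by rewrite lerDl mulr_ge0 // mulrn_wge0.
Qed.

Lemma pow_unbounded x y : 1 < x -> exists n : nat, `|y| < x ^+ n.
Proof.
move=> x1; have [n hn] := archi (y / (x - 1)); exists n.
have x10 : 0 < x - 1 by rewrite subr_gt0.
rewrite normf_div (gtr0_norm x10) ltr_pdivrMr // mulrC mulr_natr in hn.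
apply: lt_le_trans hn _; rewrite -[x in leRHS](subrKC 1).
by apply: le_trans (bernoulli n (ltW x10)); rewrite lerDr.
Qed.

Lemma pow_small x e : 0 <= x < 1 -> 0 < e ->
  exists M : nat, forall n, (M <= n)%N -> x ^+ n < e.
Proof.
move=> /andP[x0 x1] e0; have [->|xn0] := eqVneq x 0.
  by exists 1%N => -[|n] // _; rewrite expr0n.
have {}x0 : 0 < x by rewrite lt_def xn0.
have [|M hM] := @pow_unbounded x^-1 e^-1; first by rewrite invf_gt1.
exists M => n Mn; apply: le_lt_trans (_ : x ^+ M < e).
  by rewrite ler_wiXn2l // ltW.
rewrite gtr0_norm ?invr_gt0 // exprVn ltf_pV2 // in hM.
by rewrite posrE exprn_gt0.
Qed.

(** Multiplicative constants disappear when an inequality between N-th powers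
    holds for every N. It turns the estimates for products over the N-th roots of
    unity into sharp inequalities. *)
Lemma le_of_pow_le (x y A B : C) : 0 <= x -> 0 <= y -> 0 < A ->
  (forall N, (0 < N)%N -> A * x ^+ N <= B * y ^+ N) -> x <= y.
Proof.
move=> x0 y0 A0 h; rewrite real_leNgt ?ger0_real //; apply/negP => yx.
have {}x0 : 0 < x by apply: le_lt_trans yx.
have [y00|yn0] := eqVneq y 0.
  by have := h 1%N isT; rewrite y00 !expr1 mulr0 lt_geF // mulr_gt0.
have {}y0 : 0 < y by rewrite lt_def yn0.
have xy1 : 1 < x / y by rewrite ltr_pdivlMr // mul1r.
have [n hn] := pow_unbounded (B / A) xy1.
have B0 : 0 <= B.
  have := h 1%N isT; rewrite !expr1 => hB.
  rewrite -(pmulr_lge0 _ y0); apply: le_trans hB.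
  by rewrite mulr_ge0 // ltW.
rewrite normf_div (ger0_norm B0) (gtr0_norm A0) in hn.
have := h n.+1 isT; rewrite lt_geF //.
rewrite ltr_pdivrMr // mulrC in hn.
have -> : A * x ^+ n.+1 = A * (x / y) ^+ n.+1 * y ^+ n.+1.
  by rewrite -mulrA -exprMn divfK.
rewrite ltr_pM2r ?exprn_gt0 //.
by apply: lt_le_trans hn _; rewrite ler_pM2l // ler_eXn2l.
Qed.
End PowerGrowth.

(** * Rouche's theorem for polynomials *)

Section Mahler.
Variable C : numClosedFieldType.
Hypothesis archi : forall x : C, exists n : nat, `|x| < n%:R.
Implicit Types (c d r z : C) (s : seq C).

(** Splitting X^N - 1 gives the roots of unity together with the two properties
    that averaging over them uses: the modulus and the product formula. *)
Lemma nth_roots_of_unity N : (0 < N)%N ->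
  exists2 s : seq C, size s = N /\ {in s, forall x, `|x| = 1} &
    forall y, \prod_(x <- s) (y - x) = y ^+ N - 1.
Proof.
move=> N0; have [s] := closed_field_poly_normal ('X^N - 1 : {poly C}).
rewrite lead_coefXnsubC // scale1r => Ds.
have Es y : \prod_(x <- s) (y - x) = y ^+ N - 1.
  transitivity ('X^N - 1 : {poly C}).[y]; last by rewrite !hornerE.
  by rewrite Ds horner_prod; apply: eq_bigr => x _; rewrite !hornerE.
exists s => //; split=> [|x xs].
  by apply/succn_inj; rewrite -(size_prod_XsubC s id) -Ds size_XnsubC.
apply/eqP; rewrite -(@pexpr_eq1 _ _ N) // -normrX.
have := Es x; rewrite (big_rem x) //= subrr mul0r => /eqP.
by rewrite eq_sym subr_eq0 => /eqP ->; rewrite normr1.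
Qed.

Definition factored c s z := c * \prod_(x <- s) (z - x).

Definition norm_max r d := if `|d| < r then r else `|d|.

(** By Jensen's formula this is the geometric mean of the modulus of
    [factored c s] over the circle of centre [z0] and radius [r]. *)
Definition mahler c s z0 r := `|c| * \prod_(x <- s) norm_max r (x - z0).

Lemma norm_max_gt0 r d : 0 < r -> 0 < norm_max r d.
Proof.
move=> r0; rewrite /norm_max.
have [//|rd] := real_ltP (normr_real d) (gtr0_real r0).
exact: lt_le_trans rd.
Qed.

Lemma mahler_gt0 c s z0 r : 0 < r -> c != 0 -> 0 < mahler c s z0 r.
Proof.
move=> r0 c0; rewrite mulr_gt0 ?normr_gt0 //.
by apply: prodr_gt0 => x _; apply: norm_max_gt0.
Qed.

Lemma subX_ge (x y : C) N : 0 <= x -> x < y -> (0 < N)%N ->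
  (1 - x / y) * y ^+ N <= y ^+ N - x ^+ N.
Proof.
move=> x0 xy; case: N => // N _; have y0 := le_lt_trans x0 xy.
rewrite mulrBl mul1r lerD2l lerN2 !exprS mulrA divfK ?gt_eqF //.
by rewrite ler_wpM2l // lerXn2r // ?nnegrE ltW.
Qed.

(** Up to a positive constant that does not depend on [N], the larger of the
    two powers decides the size of their difference. *)
Lemma norm_max_lower r d : 0 < r -> `|d| != r ->
  exists2 a, 0 < a & forall N, (0 < N)%N ->
    a * norm_max r d ^+ N <= `|d ^+ N - r ^+ N|.
Proof.
move=> r0 dr; rewrite /norm_max.
have [dr'|rd|/eqP] := real_ltgtP (normr_real d) (gtr0_real r0).
- exists (1 - `|d| / r) => [|N N0]; first by rewrite subr_gt0 ltr_pdivrMr ?mul1r.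
  apply: le_trans (subX_ge _ dr' N0) _ => //.
  by rewrite distrC -[X in X - _]gtr0_norm ?exprn_gt0 // -normrX lerB_dist.
- exists (1 - r / `|d|) => [|N N0].
    by rewrite subr_gt0 ltr_pdivrMr ?mul1r // (lt_trans r0).
  apply: le_trans (subX_ge _ rd N0) _; first exact: ltW.
  by rewrite -[X in _ - X]gtr0_norm ?exprn_gt0 // -normrX lerB_dist.
- by rewrite (negPf dr).
Qed.

Lemma norm_max_upper r d N : 0 < r ->
  `|d ^+ N - r ^+ N| <= 2 * norm_max r d ^+ N.
Proof.
move=> r0; apply: le_trans (ler_normB _ _) _.
rewrite mulrDl mul1r !normrX (gtr0_norm r0).
have [hd hr] : `|d| <= norm_max r d /\ r <= norm_max r d.
  rewrite /norm_max.
  by have [/ltW|] := real_ltP (normr_real d) (gtr0_real r0).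
by rewrite lerD // lerXn2r // ?nnegrE ?(ltW (norm_max_gt0 _ r0)) // ltW.
Qed.

Lemma prod_norm_max_lower s z0 r : 0 < r ->
  {in s, forall x, `|x - z0| != r} ->
  exists2 a, 0 < a & forall N, (0 < N)%N ->
    a * (\prod_(x <- s) norm_max r (x - z0)) ^+ N <=
      \prod_(x <- s) `|(x - z0) ^+ N - r ^+ N|.
Proof.
move=> r0; elim: s => [|x s IH] hs.
  by exists 1 => // N _; rewrite !big_nil expr1n mulr1.
have [|a a0 ha] := IH; first by move=> y ys; apply: hs; rewrite inE ys orbT.
have [|e e0 he] := @norm_max_lower r (x - z0) r0.
  by apply: hs; rewrite mem_head.
exists (e * a) => [|N N0]; first exact: mulr_gt0.
rewrite !big_cons exprMn mulrACA ler_pM ?ha ?he //.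
  by rewrite mulr_ge0 ?exprn_ge0 // ltW // norm_max_gt0.
rewrite mulr_ge0 ?exprn_ge0 ?(ltW a0) //.
by apply: prodr_ge0 => y _; rewrite ltW ?norm_max_gt0.
Qed.

Lemma prod_norm_max_upper s z0 r N : 0 < r ->
    \prod_(x <- s) `|(x - z0) ^+ N - r ^+ N| <=
  2 ^+ size s * (\prod_(x <- s) norm_max r (x - z0)) ^+ N.
Proof.
move=> r0; elim: s => [|x s IH].
  by rewrite !big_nil expr1n mulr1.
rewrite !big_cons exprMn exprS mulrACA ler_pM ?norm_max_upper //.
by apply: prodr_ge0.
Qed.

Lemma prodr_const_seq s (x : C) : \prod_(i <- s) x = x ^+ size s.
Proof. by rewrite big_const_seq count_predT iter_mulr_1. Qed.

(** Exchange the two products: for a single root the product over the roots of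
    unity is a value of [X^N - 1]. *)
Lemma prod_circle_factored c s z0 r (rt : seq C) N : 0 < r -> size rt = N ->
  (forall y, \prod_(x <- rt) (y - x) = y ^+ N - 1) ->
  \prod_(w <- rt) `|factored c s (z0 + r * w)| =
    `|c| ^+ N * \prod_(x <- s) `|(x - z0) ^+ N - r ^+ N|.
Proof.
move=> r0 srt hrt; under eq_bigr do rewrite normrM normr_prod.
rewrite big_split /= prodr_const_seq srt; congr (_ * _).
rewrite exchange_big /=; apply: eq_bigr => x _.
have rn0 : r != 0 by rewrite gt_eqF.
rewrite (_ : _ - _ = r ^+ N * (((x - z0) / r) ^+ N - 1)); last first.
  by rewrite expr_div_n mulrBr mulr1 mulrCA divff ?mulr1 // expf_neq0.
rewrite -hrt -{1}srt normrM normrX normr_prod -prodr_const_seq -big_split /=.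
apply: eq_bigr => w _; rewrite -normrM distrC mulrBr mulrCA divff // mulr1.
by congr `|_|; ring.
Qed.

(** Jensen's formula replaces integration here: the product of the values at
    [N] equidistributed points of the circle is the [N]-th power of the Mahler
    measure, up to constants independent of [N]. *)
Lemma mahler_le (B : C) c s c' s' z0 r : 0 < r -> 0 <= B -> c != 0 ->
  {in s, forall x, `|x - z0| != r} ->
  (forall z, `|z - z0| = r -> `|factored c s z| <= B * `|factored c' s' z|) ->
  mahler c s z0 r <= B * mahler c' s' z0 r.
Proof.
move=> r0 B0 c0 hs hle; have [a a0 ha] := prod_norm_max_lower r0 hs.
have M0 d t : 0 <= mahler d t z0 r.
  rewrite mulr_ge0 //; apply: prodr_ge0 => x _; exact/ltW/norm_max_gt0.
apply: (@le_of_pow_le _ archi _ _ a (2 ^+ size s')) => // [|N N0].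
  by rewrite mulr_ge0.
have [rt [srt nrt] hrt] := nth_roots_of_unity N0.
rewrite exprMn mulrCA.
apply: le_trans (_ : `|c| ^+ N * \prod_(x <- s) `|(x - z0) ^+ N - r ^+ N| <= _).
  by rewrite ler_wpM2l ?exprn_ge0 // ha.
rewrite -(prod_circle_factored c s z0 r0 srt hrt).
apply: le_trans (_ : \prod_(w <- rt) (B * `|factored c' s' (z0 + r * w)|) <= _).
  rewrite !big_seq; apply: ler_prod => w wrt; rewrite normr_ge0 hle //.
  by rewrite addrAC subrr add0r normrM (nrt w) // mulr1 gtr0_norm.
rewrite big_split /= prodr_const_seq srt (prod_circle_factored c' s' z0 r0 srt hrt).
rewrite exprMn [leRHS]mulrCA ler_wpM2l ?exprn_ge0 // exprMn [leRHS]mulrCA.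
by rewrite ler_wpM2l ?exprn_ge0 // prod_norm_max_upper.
Qed.

(** Each root inside the annulus contributes the ratio of the radii, each root
    outside contributes nothing; so the growth of the Mahler measure across a
    root-free annulus counts the enclosed roots. *)
Lemma mahler_scale4 c s z0 r : 0 < r ->
  {in s, forall x, ~~ (r <= `|x - z0| <= 4 * r)} ->
  mahler c s z0 (4 * r) =
    4 ^+ count (fun x => `|x - z0| < 4 * r) s * mahler c s z0 r.
Proof.
move=> r0 hs; rewrite /mahler mulrCA; congr (_ * _).
elim: s hs => [|x s IH] hs; first by rewrite !big_nil mulr1.
rewrite !big_cons IH => [|y ys]; last by apply: hs; rewrite inE ys orbT.
rewrite mulrA mulrA /= exprD; congr (_ * _); rewrite mulrAC; congr (_ * _).
have := hs _ (mem_head _ _); rewrite /norm_max.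
have r4 : r <= 4 * r by rewrite ler_peMl ?ler1n // ltW.
have [d4|d4] := real_ltP (normr_real (x - z0)) (gtr0_real (lt_le_trans r0 r4)).
  rewrite (ltW d4) andbT expr1.
  by have [|] := real_ltP (normr_real (x - z0)) (gtr0_real r0).
by rewrite (le_gtF (le_trans r4 d4)) expr0 mul1r.
Qed.

(** If two polynomials stay within a factor between 1/2 and 3/2 of each other on
    the annulus, the growths of their Mahler measures across it differ at most by
    a factor 3. The growths being powers of 4, they agree. *)
Lemma rouche_factored c s c' s' z0 r : 0 < r -> c != 0 -> c' != 0 ->
  (forall z, r <= `|z - z0| <= 4 * r -> factored c' s' z != 0 /\
     `|factored c s z - factored c' s' z| <= `|factored c' s' z| / 2) ->
  count (fun x => `|x - z0| < 4 * r) s = count (fun x => `|x - z0| < 4 * r) s'.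
Proof.
move=> r0 c0 c'0 h.
have root0 d t x : x \in t -> factored d t x = 0.
  by move=> xt; rewrite /factored (big_rem x) //= subrr mul0r mulr0.
have le1 z : r <= `|z - z0| <= 4 * r ->
    `|factored c s z| <= 3 / 2 * `|factored c' s' z|.
  move=> /h[_ hz]; rewrite -[factored c s z](subrK (factored c' s' z)).
  apply: le_trans (ler_normD _ _) _.
  rewrite (_ : 3 / 2 * _ = `|factored c' s' z| / 2 + `|factored c' s' z|).
    by rewrite lerD2r.
  by field.
have le2 z : r <= `|z - z0| <= 4 * r ->
    `|factored c' s' z| <= 2 * `|factored c s z|.
  move=> /h[_ hz]; have := lerB_dist (factored c' s' z) (factored c s z).
  rewrite distrC => /le_trans /(_ hz); rewrite lerBlDr -lerBlDl.
  rewrite (_ : _ - _ = `|factored c' s' z| / 2); last by field.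
  by rewrite ler_pdivrMr // mulrC.
have hs' : {in s', forall x, ~~ (r <= `|x - z0| <= 4 * r)}.
  by move=> x xs; apply/negP => /h[]; rewrite root0 ?eqxx.
have hs : {in s, forall x, ~~ (r <= `|x - z0| <= 4 * r)}.
  move=> x xs; apply/negP => hx; have [] := h _ hx.
  by rewrite -normr_le0 (le_trans (le2 _ hx)) // root0 // normr0 mulr0.
have r4 : r <= 4 * r by rewrite ler_peMl ?ler1n // ltW.
have r40 : 0 < 4 * r by rewrite (lt_le_trans r0).
have off (u : C) (v : seq C) : r <= u <= 4 * r ->
    {in v, forall x, ~~ (r <= `|x - z0| <= 4 * r)} ->
    {in v, forall x, `|x - z0| != u}.
  by move=> hu hv x /hv; apply: contraNneq => ->.
have rr : r <= r <= 4 * r by rewrite lexx.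
have rr4 : r <= 4 * r <= 4 * r by rewrite lexx andbT.
have Ms := mahler_scale4 c r0 hs; have Ms' := mahler_scale4 c' r0 hs'.
set n := count _ s in Ms *; set n' := count _ s' in Ms' *.
have B0 : 0 <= 3 / 2 :> C by rewrite divr_ge0.
have ub1 : mahler c s z0 (4 * r) <= 3 / 2 * mahler c' s' z0 (4 * r).
  by apply: (mahler_le r40 B0 c0 (off _ _ rr4 hs)) => z zr; apply: le1; rewrite zr.
have ub2 : mahler c s z0 r <= 3 / 2 * mahler c' s' z0 r.
  by apply: (mahler_le r0 B0 c0 (off _ _ rr hs)) => z zr; apply: le1; rewrite zr.
have lb1 : mahler c' s' z0 (4 * r) <= 2 * mahler c s z0 (4 * r).
  apply: (mahler_le r40 (ler0n C 2) c'0 (off _ _ rr4 hs')) => z zr.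
  by apply: le2; rewrite zr.
have lb2 : mahler c' s' z0 r <= 2 * mahler c s z0 r.
  apply: (mahler_le r0 (ler0n C 2) c'0 (off _ _ rr hs')) => z zr.
  by apply: le2; rewrite zr.
have M0 := mahler_gt0 s z0 r0 c0; have M0' := mahler_gt0 s' z0 r0 c'0.
have key k l : 4 ^+ k <= 3 * 4 ^+ l :> C -> (k <= l)%N.
  move=> kl; rewrite leqNgt; apply/negP => lk.
  have : 4 ^+ l.+1 <= 3 * 4 ^+ l :> C by apply: le_trans kl; rewrite ler_eXn2l ?ltr1n.
  by rewrite exprS ler_pM2r ?exprn_gt0 // ler_nat.
apply/eqP; rewrite eqn_leq; apply/andP; split; apply: key.
  rewrite -(ler_pM2r M0) -Ms; apply: le_trans ub1 _.
  rewrite Ms' [leLHS]mulrCA [leRHS](_ : _ = 4 ^+ n' * (3 / 2 * (2 * mahler c s z0 r))).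
    by rewrite ler_pM2l ?exprn_gt0 // ler_pM2l // divr_gt0.
  by field.
rewrite -(ler_pM2r M0') -Ms'; apply: le_trans lb1 _.
rewrite Ms [leLHS]mulrCA [leRHS](_ : _ = 4 ^+ n * (2 * (3 / 2 * mahler c' s' z0 r))).
  by rewrite ler_pM2l ?exprn_gt0 // ler_pM2l.
by field.
Qed.
End Mahler.

(** * The Szego recursion and its transfer matrices *)

Section SzegoRecursion.
Variable C : numClosedFieldType.
Implicit Types (alpha : nat -> C) (z : C) (n k : nat) (q : {poly C}).

(** The common leading coefficient of [phi alpha n] and [psi alpha n]. *)
Definition leading alpha n : C := \prod_(k < n) (rho alpha k)^-1.

Definition in_disc alpha := forall n, `|alpha n| < 1.

Lemma rho_gt0 alpha n : in_disc alpha -> 0 < rho alpha n.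
Proof.
by move=> ha; rewrite sqrtC_gt0 subr_gt0 expr_lt1.
Qed.

Lemma rho_sqr alpha n : rho alpha n ^+ 2 = 1 - alpha n * (alpha n)^*.
Proof. by rewrite sqrtCK -normCK. Qed.

Lemma rhoN alpha n : rho (fun k => - alpha k) n = rho alpha n.
Proof. by rewrite /rho normrN. Qed.

Lemma conj_rhoV alpha n : in_disc alpha -> ((rho alpha n)^-1)^* = (rho alpha n)^-1.
Proof.
by move=> ha; rewrite geC0_conj // invr_ge0 ltW ?rho_gt0.
Qed.

Lemma in_discN alpha : in_disc alpha -> in_disc (fun k => - alpha k).
Proof. by move=> ha n; rewrite normrN. Qed.

Lemma leading_gt0 alpha n : in_disc alpha -> 0 < leading alpha n.
Proof. by move=> ha; apply: prodr_gt0 => k _; rewrite invr_gt0 rho_gt0. Qed.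

Lemma leadingN alpha n : leading (fun k => - alpha k) n = leading alpha n.
Proof. by apply: eq_bigr => k _; rewrite rhoN. Qed.

Lemma leadingS alpha n : leading alpha n.+1 = (rho alpha n)^-1 * leading alpha n.
Proof. by rewrite /leading big_ord_recr mulrC. Qed.

Lemma coef_star n q i : (star_poly n q)`_i = if (i <= n)%N then (q`_(n - i))^* else 0.
Proof. by rewrite coef_poly ltnS. Qed.

Lemma phiS alpha n : phi alpha n.+1 = (rho alpha n)^-1 *:
   ('X * phi alpha n - (alpha n)^* *: star_poly n (phi alpha n)).
Proof. by []. Qed.

Lemma size_phi_le alpha n : (size (phi alpha n) <= n.+1)%N.
Proof.
elim: n => [|n IH]; first by rewrite size_poly1.
rewrite phiS (leq_trans (size_scale_leq _ _)) // (leq_trans (size_polyD _ _)) //.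
rewrite geq_max size_polyN; apply/andP; split.
  by rewrite (leq_trans (size_polyMleq _ _)) // size_polyX.
rewrite (leq_trans (size_scale_leq _ _)) // (leq_trans (size_poly _ _)) //.
Qed.

Lemma coef_phi_lead alpha n : (phi alpha n)`_n = leading alpha n.
Proof.
elim: n => [|n IH]; first by rewrite coef1 /leading big_ord0.
by rewrite phiS coefZ coefB coefXM coefZ coef_star ltnn mulr0 subr0 IH leadingS.
Qed.

Lemma size_phi alpha n : in_disc alpha -> size (phi alpha n) = n.+1.
Proof.
move=> ha; apply/eqP; rewrite eqn_leq size_phi_le ltnNge; apply/negP => h.
by have := leading_gt0 n ha; rewrite -coef_phi_lead nth_default // ltxx.
Qed.

Lemma phi_neq0 alpha n : in_disc alpha -> phi alpha n != 0.
Proof. by move=> ha; rewrite -size_poly_gt0 size_phi. Qed.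

Lemma lead_coef_phi alpha n : in_disc alpha -> lead_coef (phi alpha n) = leading alpha n.
Proof. by move=> ha; rewrite lead_coefE size_phi // coef_phi_lead. Qed.

Lemma star_phi0 alpha n : in_disc alpha -> (star_poly n (phi alpha n)).[0] = leading alpha n.
Proof.
move=> ha; rewrite horner_coef0 coef_star subn0 coef_phi_lead geC0_conj //.
exact/ltW/leading_gt0.
Qed.

Lemma phi0 alpha n : in_disc alpha -> (phi alpha n.+1).[0] = - (alpha n)^* * leading alpha n.+1.
Proof.
move=> ha; rewrite phiS !hornerE star_phi0 // leadingS; ring.
Qed.

Lemma star_phiS alpha n : in_disc alpha -> star_poly n.+1 (phi alpha n.+1) = (rho alpha n)^-1 *:
   (star_poly n (phi alpha n) - alpha n *: ('X * phi alpha n)).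
Proof.
move=> ha; apply/polyP => i.
rewrite phiS !(coef_star, coefZ, coefB, coefXM).
case: i => [|i].
  rewrite subn0 ltnn mulr0 subr0 /= !subn0 mulr0 subr0 rmorphM /= conj_rhoV //.
rewrite ltnS subSS; have [ni|ni] /= := ltnP i n; last first.
  rewrite sub0r; have [->|nin] := eqVneq i n.
    rewrite leqnn subnn /= sub0r subn0 rmorphM rmorphN rmorphM /= conj_rhoV //=.
    by rewrite !conjCK.
  rewrite leqNgt ltn_neqAle eq_sym nin ni /=.
  rewrite [_`_i]nth_default ?mulr0 ?oppr0 ?mulr0 //.
  by rewrite (leq_trans (size_phi_le _ _)) // ltn_neqAle eq_sym nin.
rewrite (ltnW ni) subn_eq0 leqNgt ni /= leq_subr subKn 1?ltnW //.
rewrite rmorphM rmorphB rmorphM /= conj_rhoV // !conjCK.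
by rewrite -subn1 -subnDA addn1.
Qed.

Definition shift (k : nat) alpha : nat -> C := fun n => alpha (n + k)%N.

Lemma mx2M (a b c d a' b' c' d' : C) : mx2 a b c d *m mx2 a' b' c' d' =
  mx2 (a * a' + b * c') (a * b' + b * d') (c * a' + d * c') (c * b' + d * d').
Proof.
apply/matrixP => i j; rewrite !mxE !big_ord_recl big_ord0 addr0 !mxE.
by case: i => -[|[|]] // hi; case: j => -[|[|]].
Qed.

Lemma mx2Z (x a b c d : C) : x *: mx2 a b c d = mx2 (x * a) (x * b) (x * c) (x * d).
Proof.
apply/matrixP => i j; rewrite !mxE.
by case: i => -[|[|]] // hi; case: j => -[|[|]].
Qed.

Lemma mx2_inj (a b c d a' b' c' d' : C) : mx2 a b c d = mx2 a' b' c' d' ->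
  [/\ a = a', b = b', c = c' & d = d'].
Proof.
move/matrixP => h.
by split; [have:=h 0 0|have:=h 0 1|have:=h 1 0|have:=h 1 1]; rewrite !mxE.
Qed.

Lemma mx2_tr (a b c d : C) : \tr (mx2 a b c d) = a + d.
Proof. by rewrite /mxtrace !big_ord_recl big_ord0 addr0 !mxE. Qed.

Lemma mx2_1 : 1%:M = mx2 (1 : C) 0 0 1.
Proof.
apply/matrixP => i j; rewrite !mxE.
by case: i => -[|[|]] // hi; case: j => -[|[|]].
Qed.

(** The entries of the transfer matrix: the vectors (1,1) and (1,-1) are sent
    to (phi, phi^* ) and (psi, - psi^* ). *)
Definition tr11 alpha n : {poly C} := 2^-1 *: (phi alpha n + psi alpha n).
Definition tr12 alpha n : {poly C} := 2^-1 *: (phi alpha n - psi alpha n).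
Definition tr21 alpha n : {poly C} :=
  2^-1 *: (star_poly n (phi alpha n) - star_poly n (psi alpha n)).
Definition tr22 alpha n : {poly C} :=
  2^-1 *: (star_poly n (phi alpha n) + star_poly n (psi alpha n)).

Lemma transferE alpha n z : in_disc alpha -> transfer alpha n z =
  mx2 (tr11 alpha n).[z] (tr12 alpha n).[z] (tr21 alpha n).[z] (tr22 alpha n).[z].
Proof.
move=> ha; elim: n => [|n IH] /=.
  rewrite mx2_1 /tr11 /tr12 /tr21 /tr22 /psi /=.
  have -> : star_poly 0 (1 : {poly C}) = 1.
    apply/polyP => i; rewrite coef_star !coef1.
    by case: i => [|i] //; rewrite subn0 eqxx rmorph1.
  by rewrite !hornerE; congr mx2; field.
have ha' := in_discN ha.
rewrite IH /transfer1 mx2Z mx2M /tr11 /tr12 /tr21 /tr22 /psi !star_phiS // !phiS rhoN.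
by rewrite rmorphN /= !(hornerZ, hornerD, hornerN, hornerM, hornerX);
  congr mx2; field; rewrite gt_eqF ?rho_gt0.
Qed.

Lemma half_double q : 2^-1 *: (q + q) = q.
Proof. by rewrite -mulr2n -(scaler_nat 2 q) scalerA mulVf ?scale1r // pnatr_eq0. Qed.

Lemma phi_tr alpha n : phi alpha n = tr11 alpha n + tr12 alpha n.
Proof. by rewrite -scalerDr addrACA subrr addr0 half_double. Qed.

Lemma star_phi_tr alpha n : star_poly n (phi alpha n) = tr21 alpha n + tr22 alpha n.
Proof. by rewrite -scalerDr addrACA addNr addr0 half_double. Qed.

Lemma transfer_det alpha n z : in_disc alpha ->
  (tr11 alpha n).[z] * (tr22 alpha n).[z] - (tr12 alpha n).[z] * (tr21 alpha n).[z]
   = z ^+ n.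
Proof.
move=> ha; elim: n => [|n IH].
  have := transferE 0 z ha; rewrite /= mx2_1 => /mx2_inj[<- <- <- <-].
  by rewrite !mulr1 mulr0 subr0.
have := transferE n.+1 z ha; rewrite /= /transfer1 transferE // mx2Z mx2M.
case/mx2_inj=> <- <- <- <-; have r0 : rho alpha n != 0 by rewrite gt_eqF ?rho_gt0.
have -> : z ^+ n.+1 =
    (rho alpha n)^-1 ^+ 2 * (1 - alpha n * (alpha n)^*) * (z * z ^+ n).
  by rewrite -rho_sqr -exprMn mulVf // expr1n mul1r exprS.
rewrite -IH; ring.
Qed.

Lemma transfer_shift alpha m n z :
  transfer alpha (m + n) z = transfer (shift n alpha) m z *m transfer alpha n z.
Proof. by elim: m => [|m IH]; rewrite /= ?mul1mx // IH mulmxA. Qed.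

Lemma in_disc_shift alpha k : in_disc alpha -> in_disc (shift k alpha).
Proof. by move=> ha n; apply: ha. Qed.
End SzegoRecursion.

(** * Periodic coefficients: trace and eliminant *)

Section PeriodicRecurrence.
Variable C : numClosedFieldType.
Variables (alpha : nat -> C) (p : nat).
Hypothesis ha : in_disc alpha.
Hypothesis per : forall n, alpha (n + p)%N = alpha n.
Hypothesis p_gt0 : (0 < p)%N.
Implicit Types (z : C) (n b : nat).

Definition trace_poly (beta : nat -> C) n : {poly C} := tr11 beta n + tr22 beta n.

Let t := trace_poly alpha p.

Lemma transfer_period n z :
  transfer alpha (n + p) z = transfer alpha n z *m transfer alpha p z.
Proof.
by rewrite transfer_shift (_ : shift p alpha = alpha) //; apply/funext => k; apply: per.
Qed.

Lemma tr_period n z :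
  (tr11 alpha (n + p)).[z] = (tr11 alpha n).[z] * (tr11 alpha p).[z]
                             + (tr12 alpha n).[z] * (tr21 alpha p).[z] /\
  (tr12 alpha (n + p)).[z] = (tr11 alpha n).[z] * (tr12 alpha p).[z]
                             + (tr12 alpha n).[z] * (tr22 alpha p).[z].
Proof.
by have := transfer_period n z; rewrite !transferE // mx2M => /mx2_inj[].
Qed.

Lemma phi_period n z : (phi alpha (n + p)).[z] =
  (tr11 alpha n).[z] * (phi alpha p).[z] +
  (tr12 alpha n).[z] * (star_poly p (phi alpha p)).[z].
Proof.
have [e1 e2] := tr_period n z.
rewrite !star_phi_tr !phi_tr !hornerD e1 e2; ring.
Qed.

Lemma phi_rec n z : (phi alpha (n + p + p)).[z] =
  t.[z] * (phi alpha (n + p)).[z] - z ^+ p * (phi alpha n).[z].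
Proof.
have [e1 e2] := tr_period n z; have [e3 e4] := tr_period (n + p) z.
rewrite -(transfer_det p z ha) !phi_tr /t /trace_poly !hornerD e3 e4 e1 e2; ring.
Qed.

Lemma trace_at0 : t.[0] = leading alpha p.
Proof.
have [q Dp] : exists q, p = q.+1 by exists p.-1; rewrite prednK.
rewrite /t Dp /trace_poly hornerD !hornerZ !hornerD /psi !star_phi0 ?phi0 //; try exact: in_discN.
by rewrite leadingN rmorphN; field.
Qed.

Lemma coef_trace : t`_p = leading alpha p.
Proof.
rewrite /t /trace_poly coefD !coefZ !coefD !coef_star leqnn subnn !coef_phi_lead -!horner_coef0.
have [q Dp] : exists q, p = q.+1 by exists p.-1; rewrite prednK.
rewrite /psi Dp !phi0 ?leadingN ?rmorphN //; last exact: in_discN.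
by rewrite !rmorphM !rmorphN /=; field.
Qed.

Lemma size_trace : size t = p.+1.
Proof.
apply/eqP; rewrite eqn_leq ltnNge; apply/andP; split; last first.
  apply/negP => h; have := leading_gt0 p ha.
  by rewrite -coef_trace nth_default // ltxx.
have le2 (f g : {poly C}) : (size f <= p.+1)%N -> (size g <= p.+1)%N ->
    (size (2^-1 *: (f + g)) <= p.+1)%N.
  move=> hf hg; rewrite (leq_trans (size_scale_leq _ _)) //.
  by rewrite (leq_trans (size_polyD _ _)) // geq_max hf.
rewrite /t /trace_poly (leq_trans (size_polyD _ _)) // geq_max !le2 ?size_phi_le ?size_poly //.
Qed.

Lemma lead_coef_trace : lead_coef t = leading alpha p.
Proof. by rewrite lead_coefE size_trace coef_trace. Qed.

Lemma trace_neq0 : t != 0.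
Proof. by rewrite -size_poly_gt0 size_trace. Qed.

(** The characteristic polynomial of the transfer matrix over one period,
    homogenized and evaluated at the quotient of [phi alpha (b + p)] by
    [phi alpha b]. Dividing by the gap between the eigenvalues shows that each
    zero of the limit function is a root of it; the grouping displays
    the cancellation of the leading coefficients. *)
Definition eliminant b : {poly C} :=
  phi alpha (b + p) * (phi alpha (b + p) - t * phi alpha b) +
  'X^p * phi alpha b ^+ 2.

Lemma leading_period b : leading alpha (b + p) = leading alpha p * leading alpha b.
Proof.
rewrite /leading addnC big_split_ord /=; congr (_ * _); apply: eq_bigr => k _.
by rewrite addnC /rho per.
Qed.

Lemma size_eliminant b : (size (eliminant b) <= 2 * p + 2 * b)%N.
Proof.
rewrite (leq_trans (size_polyD _ _)) // geq_max; apply/andP; split; last first.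
  rewrite (leq_trans (size_polyMleq _ _)) // size_polyXn addSn /=.
  rewrite expr2; apply: leq_trans (_ : p + (b.+1 + b.+1).-1 <= _)%N.
    rewrite leq_add2l (leq_trans (size_polyMleq _ _)) //.
    by rewrite -!subn1 leq_sub2r // leq_add ?size_phi_le.
  by rewrite addSn /= addnS addnS !mul2n -!addnn -addSn leq_add2r -addn1 leq_add2l.
have sb : size (t * phi alpha b) = (b + p).+1.
  rewrite size_mul ?trace_neq0 ?phi_neq0 //.
  by rewrite size_trace size_phi // addSn /= addnS addnC.
have sd : (size (phi alpha (b + p) - t * phi alpha b)%R <= b + p)%N.
  apply/leq_sizeP => i; rewrite leq_eqVlt => /orP[/eqP <-|hi]; last first.
    by rewrite coefB !nth_default ?subr0 ?sb // size_phi.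
  rewrite coefB coef_phi_lead leading_period.
  have -> : (b + p)%N = (size (t * phi alpha b)).-1 by rewrite sb.
  by rewrite -lead_coefE lead_coefM lead_coef_trace lead_coef_phi // subrr.
rewrite (leq_trans (size_polyMleq _ _)) // size_phi // addSn /=.
by rewrite -mulnDr mul2n -addnn [(p + b)%N]addnC leq_add2l.
Qed.

Lemma horner_eq0 (q : {poly C}) : (forall z, q.[z] = 0) -> q = 0.
Proof.
move=> q0; have [/closed_rootP[z]|] := boolP (size (q + 1) != 1%N).
  by rewrite rootE hornerD q0 add0r -polyC1 hornerC oner_eq0.
rewrite negbK => /size_poly1P[c _ /(canRL (addrK _)) Dq].
by move: (q0 0); rewrite Dq -polyCB hornerC => ->.
Qed.

(** For a 2x2 matrix T, a row u and a column v, the form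
    (uTv)^2 - tr T (uTv)(uv) + det T (uv)^2 is up to sign
    det (v | Tv) * det (u / uT): it vanishes exactly when v or u is an
    eigenvector. Here v = (1,1) and u is the first row of the transfer matrix up
    to [b], which conjugates T into the transfer matrix of the shifted
    coefficients. *)
Lemma eliminant_factor b : eliminant b =
  (phi alpha p - star_poly p (phi alpha p)) * ('X^b * tr12 (shift b alpha) p).
Proof.
apply/eqP; rewrite -subr_eq0; apply/eqP/horner_eq0 => z.
have hb : in_disc (shift b alpha) by apply: in_disc_shift.
have := transfer_shift alpha p b z; rewrite addnC transfer_period !transferE //.
rewrite !mx2M => /mx2_inj[+ + _ _].
have [e3 e4] := tr_period b z.
rewrite /eliminant /t /trace_poly !star_phi_tr !phi_tr.
rewrite !(hornerD, hornerN, hornerM, hornerXn, horner_exp) e3 e4.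
rewrite -(transfer_det b z ha) -(transfer_det p z ha).
set s11 := (tr11 (shift _ _) _).[z]; set s12 := (tr12 (shift _ _) _).[z].
move: (tr11 alpha b).[z] (tr12 alpha b).[z] (tr21 alpha b).[z]
  (tr22 alpha b).[z] (tr11 alpha p).[z] (tr12 alpha p).[z] (tr21 alpha p).[z]
  (tr22 alpha p).[z] => u1 u2 l1 l2 a c d e e1 e2.
apply/eqP; rewrite subr_eq0; apply/eqP.
transitivity ((a + c - (d + e)) * (u1 * (u1 * c + u2 * e) - u2 * (u1 * a + u2 * d))).
  by ring.
by rewrite e1 e2; ring.
Qed.

(** The equation phi = psi, read at 0, says that the last coefficient is 0; then
    both polynomials are the previous ones times X, and the equation descends. *)
Lemma tr12_eq0_alpha (beta : nat -> C) n : in_disc beta -> tr12 beta n = 0 ->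
  forall k, (k < n)%N -> beta k = 0.
Proof.
move=> hb; elim: n => [|n IH] //.
move/eqP; rewrite scaler_eq0 invr_eq0 pnatr_eq0 /= subr_eq0 => /eqP E.
have b0 : beta n = 0.
  have := congr1 (fun q : {poly C} => q.[0]) E.
  rewrite /psi !phi0 //; last exact: in_discN.
  rewrite leadingN rmorphN opprK => /(mulIf _) h.
  have /eqP := h (lt0r_neq0 (leading_gt0 _ hb)).
  by rewrite eq_sym -addr_eq0 -mulr2n mulrn_eq0 /= conjC_eq0 => /eqP.
move=> k; rewrite ltnS leq_eqVlt => /orP[/eqP ->//|]; apply: IH.
move: E; rewrite /psi !phiS rhoN b0 oppr0 rmorph0 !scale0r !subr0.
have r0 : (rho beta n)^-1 != 0 by rewrite invr_eq0 gt_eqF ?rho_gt0.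
move/(scalerI r0)/(mulfI (negbT (polyX_eq0 _))) => E.
by rewrite /tr12 /psi -E subrr scaler0.
Qed.

Lemma period_mul m j : alpha (m + j * p)%N = alpha m.
Proof. by elim: j => [|j IH]; rewrite ?addn0 // mulSn addnCA addnC per. Qed.

Lemma eliminant_neq0 b : (exists n, alpha n != 0) -> eliminant b != 0.
Proof.
move=> [n an]; rewrite eliminant_factor mulf_neq0 ?mulf_neq0 ?(monic_neq0 (monicXn _ _)) //.
  apply/eqP => /(congr1 (fun q : {poly C} => q.[0])).
  have [q Dp] : exists q, p = q.+1 by exists p.-1; rewrite prednK.
  rewrite Dp hornerD hornerN star_phi0 // phi0 // horner0 => /eqP.
  rewrite -[X in _ - X]mul1r -mulrBl mulf_eq0 (gt_eqF (leading_gt0 _ ha)) orbF.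
  rewrite -opprD oppr_eq0 addr_eq0 => /eqP /(congr1 Num.norm).
  by rewrite norm_conjC normrN1 => E; have := ha q; rewrite E ltxx.
apply: contraNneq an => E.
have hb : in_disc (shift b alpha) by apply: in_disc_shift.
(* Adding [b] periods makes the index at least [b], where the shifted
   coefficients live. *)
have le_bp : (b <= b * p)%N by rewrite leq_pmulr.
rewrite -(period_mul n b) -(subnK (leq_trans le_bp (leq_addl n _))).
set m := (_ - b)%N; rewrite (divn_eq m p) -addnA addnC period_mul.
by apply/eqP/(tr12_eq0_alpha hb E); rewrite ltn_mod.
Qed.
End PeriodicRecurrence.

(** * Eigenvalues of the transfer matrix over one period *)

Section Eigenvalues.
Variable C : numClosedFieldType.
Variables (alpha : nat -> C) (p : nat).
Hypothesis ha : in_disc alpha.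
Hypothesis p_gt0 : (0 < p)%N.
Hypothesis p_even : ~~ odd p.
Implicit Types (z w : C) (n b : nat).

Notation t := (trace_poly alpha p).

(** The eigenvalues of the transfer matrix over one period. Unlike
    [Gamma_plus], they have no pole at 0, so the recurrence and the continuity
    arguments treat 0 like any other point. *)
Definition lambda1 z := if z == 0 then t.[0] else z ^+ p./2 * Gamma_plus alpha p z.
Definition lambda2 z := t.[z] - lambda1 z.

Lemma double_half : (p./2 + p./2)%N = p.
Proof. by rewrite addnn even_halfK. Qed.

Lemma expr_double_half z : z ^+ p = z ^+ p./2 * z ^+ p./2.
Proof. by rewrite -exprD double_half. Qed.

Lemma mxtrace_transfer z : \tr (transfer alpha p z) = t.[z].
Proof. by rewrite transferE // mx2_tr hornerD. Qed.

Lemma trace_Delta z : z != 0 -> t.[z] = z ^+ p./2 * Delta alpha p z.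
Proof.
by move=> z0; rewrite /Delta mxtrace_transfer mulrA mulfV ?mul1r // expf_neq0.
Qed.

Lemma Gamma_sum z : Gamma_plus alpha p z + Gamma_minus alpha p z = Delta alpha p z.
Proof.
by rewrite /Gamma_plus /Gamma_minus; case: ifP => _; rewrite /eigen1 /eigen2; field.
Qed.

Lemma Gamma_prod z : Gamma_plus alpha p z * Gamma_minus alpha p z = 1.
Proof.
have e12 : eigen1 alpha p z * eigen2 alpha p z = 1.
  by rewrite mulrC /eigen1 /eigen2 -subr_sqr sqrtCK opprB addrC subrK.
by rewrite /Gamma_plus /Gamma_minus; case: ifP => _; rewrite // mulrC.
Qed.

Lemma Gamma_norm z : `|Gamma_minus alpha p z| <= `|Gamma_plus alpha p z|.
Proof.
rewrite /Gamma_plus /Gamma_minus.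
by case: real_ltP => //; rewrite ?normr_real // => /ltW.
Qed.

Lemma lambda1E z : z != 0 -> lambda1 z = z ^+ p./2 * Gamma_plus alpha p z.
Proof. by rewrite /lambda1 => /negPf ->. Qed.

Lemma lambda2E z : z != 0 -> lambda2 z = z ^+ p./2 * Gamma_minus alpha p z.
Proof.
by move=> z0; rewrite /lambda2 lambda1E // trace_Delta // -Gamma_sum mulrDr addrC addKr.
Qed.

Lemma lambda1_0 : lambda1 0 = leading alpha p.
Proof. by rewrite /lambda1 eqxx trace_at0. Qed.

Lemma lambda2_0 : lambda2 0 = 0.
Proof. by rewrite /lambda2 /lambda1 eqxx subrr. Qed.

Lemma lambda_sum z : lambda1 z + lambda2 z = t.[z].
Proof. by rewrite /lambda2 addrC subrK. Qed.

Lemma lambda_prod z : lambda1 z * lambda2 z = z ^+ p.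
Proof.
have [->|z0] := eqVneq z 0; first by rewrite lambda2_0 mulr0 expr0n gtn_eqF.
rewrite lambda1E // lambda2E // expr_double_half.
by rewrite mulrACA Gamma_prod mulr1.
Qed.

Lemma lambda_norm z : `|lambda2 z| <= `|lambda1 z|.
Proof.
have [->|z0] := eqVneq z 0; first by rewrite lambda2_0 normr0.
by rewrite lambda1E // lambda2E // !normrM ler_wpM2l // Gamma_norm.
Qed.

(** The eigenvalues are the roots of a quadratic polynomial, sorted by modulus;
    this characterization makes their continuity independent of any branch of
    the square root. *)
Lemma lambda_unique z l m : l + m = t.[z] -> l * m = z ^+ p -> `|m| < `|l| ->
  lambda1 z = l /\ lambda2 z = m.
Proof.
move=> lm1 lm2 ml.
have /eqP : (l - lambda1 z) * (l - lambda2 z) = 0.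
  transitivity (l ^+ 2 - (lambda1 z + lambda2 z) * l + lambda1 z * lambda2 z).
    by ring.
  by rewrite lambda_sum lambda_prod -lm1 -lm2; ring.
rewrite mulf_eq0 !subr_eq0 => /orP[/eqP l1|/eqP l2].
  by split=> //; rewrite /lambda2 -lm1 l1 addrC addKr.
have m1 : m = lambda1 z.
  by apply: (addrI l); rewrite lm1 l2 addrC lambda_sum.
by have := lambda_norm z; rewrite -m1 -l2 lt_geF.
Qed.

Definition split_point z := `|lambda2 z| < `|lambda1 z|.

Lemma lambda1_neq0 z : split_point z -> lambda1 z != 0.
Proof. by move=> hz; rewrite -normr_gt0 (le_lt_trans _ hz). Qed.

Lemma lambda_gap_neq0 z : split_point z -> lambda1 z - lambda2 z != 0.
Proof.
by move=> hz; rewrite subr_eq0; apply: contraTneq hz => e; rewrite /split_point e ltxx.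
Qed.

(** Two numbers of equal modulus and product 1 are conjugate points of the unit
    circle, so their sum is real and at most 2 in modulus. *)
Lemma unit_circle_Delta z : `|Gamma_minus alpha p z| = `|Gamma_plus alpha p z| ->
  - 2 <= Delta alpha p z <= 2.
Proof.
move=> h; have n1 : `|Gamma_plus alpha p z| = 1.
  apply/eqP; rewrite -(@pexpr_eq1 _ _ 2) // expr2 -{2}h -normrM Gamma_prod.
  by rewrite normr1.
have -> : Delta alpha p z = Gamma_plus alpha p z + (Gamma_plus alpha p z)^*.
  rewrite -Gamma_sum; congr (_ + _).
  have g0 : Gamma_plus alpha p z != 0 by rewrite -normr_eq0 n1 oner_eq0.
  apply: (mulfI g0); rewrite Gamma_prod -normCK n1 expr1n //.
rewrite -real_ler_norml; last by apply/CrealP; rewrite rmorphD /= conjCK addrC.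
by rewrite (le_trans (ler_normD _ _)) // norm_conjC n1.
Qed.

End Eigenvalues.

(** * Limits and zeros of polynomials *)

#[local] Instance closed_field_nbhs_filter (C : numClosedFieldType) (x : C) :
  ProperFilter (nbhs x) := nbhs_pfilter x.
#[local] Instance closed_field_dnbhs_filter (C : numClosedFieldType) (x : C) :
  ProperFilter x^' := Proper_dnbhs_numFieldType x.

Section PolynomialLimits.
Variable C : numClosedFieldType.
Implicit Types (q : {poly C}) (z e : C).

Lemma cvg_horner q z : q.[w] @[w --> z] --> q.[z].
Proof.
elim/poly_ind: q => [|q c IH].
  by apply: cvg_near_cst; apply: nearW => w; rewrite !horner0.
have -> : horner (q * 'X + c%:P) = fun w => q.[w] * w + c.
  by apply/funext => w; rewrite hornerMXaddC.
by apply: cvgD; [apply: cvgM; [exact: IH|exact: cvg_id]|exact: cvg_cst].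
Qed.

Lemma near_horner q z e : 0 < e -> \forall w \near z, `|q.[w] - q.[z]| < e.
Proof. by move=> e0; move/cvgrPdistC_lt: (@cvg_horner q z); apply. Qed.

Lemma zerosE q : q = lead_coef q *: \prod_(x <- zeros q) ('X - x%:P).
Proof. by rewrite /zeros; case: closed_field_poly_normal. Qed.

Lemma horner_zeros q z : q.[z] = lead_coef q * \prod_(x <- zeros q) (z - x).
Proof.
rewrite {1}[q]zerosE hornerZ horner_prod; congr (_ * _).
by apply: eq_bigr => x _; rewrite hornerXsubC.
Qed.

Lemma size_zeros q : q != 0 -> size (zeros q) = (size q).-1.
Proof.
move=> q0; rewrite {2}[q]zerosE size_scale ?lead_coef_eq0 //.
by rewrite size_prod_XsubC.
Qed.

Lemma mem_zeros q z : z \in zeros q -> q.[z] = 0.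
Proof. by move=> zq; rewrite horner_zeros (big_rem z) //= subrr mul0r mulr0. Qed.

Lemma mem_zerosE q z : q != 0 -> (z \in zeros q) = (q.[z] == 0).
Proof.
move=> q0; apply/idP/eqP => [/mem_zeros //|/eqP].
rewrite horner_zeros mulf_eq0 lead_coef_eq0 (negPf q0) /= prodf_seq_eq0.
by case/hasP => x xs /=; rewrite subr_eq0 => /eqP ->.
Qed.

(** The value of a polynomial is the product of the distances to its roots, so
    it cannot be small far from all roots. *)
Lemma root_close q z e : q != 0 -> 0 < e ->
  `|q.[z]| < `|lead_coef q| * e ^+ (size q).-1 ->
  exists2 x, q.[x] = 0 & `|z - x| < e.
Proof.
move=> q0 e0 hq.
have [/hasP[x /mem_zeros xq xe]|] := boolP (has (fun x => `|z - x| < e) (zeros q)).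
  by exists x.
move/hasPn => far; exfalso; move: hq.
rewrite horner_zeros normrM normr_prod le_gtF //.
rewrite ler_wpM2l // -size_zeros // -prodr_const_seq !big_seq.
apply: ler_prod => x xq; rewrite ltW //=.
by rewrite real_leNgt ?normr_real ?gtr0_real // far.
Qed.

Lemma common_lower_bound (a b : C) : 0 < a -> 0 < b ->
  exists c, [/\ 0 < c, c <= a & c <= b].
Proof.
move=> a0 b0; have [ab|/ltW ba] := real_leP (gtr0_real a0) (gtr0_real b0).
  by exists a.
by exists b.
Qed.
End PolynomialLimits.

(** * Off the bands the eigenvalues have distinct moduli *)

Section OffBands.
Variable C : numClosedFieldType.
Variables (alpha : nat -> C) (p : nat).
Hypothesis ha : in_disc alpha.
Hypothesis p_gt0 : (0 < p)%N.
Hypothesis p_even : ~~ odd p.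
Implicit Types (z w : C) (n b : nat).

Notation t := (trace_poly alpha p).
Notation l1 := (lambda1 alpha p).
Notation l2 := (lambda2 alpha p).
Notation split_point := (split_point alpha p).

(** The equation Delta = w is polynomial, with a leading coefficient that does
    not depend on w. Moving w slightly from 2 or -2 into (-2, 2)
    therefore moves one of its roots only slightly away from [z]. *)
Lemma band_edge z : z != 0 -> Delta alpha p z = 2 \/ Delta alpha p z = - 2 ->
  bands alpha p z.
Proof.
move=> z0 hD; set w0 := Delta alpha p z in hD.
have w02 : `|w0| = 2 by case: hD => ->; rewrite ?normrN normr_nat.
move=> U /nbhs_normP[e /= e0 hU].
have h_gt0 : (0 < p./2)%N by rewrite half_gt0; case: (p) p_gt0 p_even => [|[|]].
have hp : (p./2 < p)%N by rewrite -{2}(double_half p_even) -addn1 leq_add2l.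
set A := leading alpha p * e ^+ p; set B := 2 * `|z| ^+ p./2.
have A0 : 0 < A by rewrite mulr_gt0 ?leading_gt0 ?exprn_gt0.
have B0 : 0 < B by rewrite mulr_gt0 ?exprn_gt0 ?normr_gt0.
have AB0 : 0 < A + B by rewrite addr_gt0.
(* [d] is chosen with d < 1 and d * B < A. *)
pose d := A / (A + B).
have d0 : 0 < d by rewrite divr_gt0.
have d1 : d < 1 by rewrite ltr_pdivrMr // mul1r ltrDl.
pose w := w0 * (1 - d).
have wlt : - 2 < w < 2.
  have d2 : 0 < 1 - d by rewrite subr_gt0.
  have d3 : 2 * (1 - d) < 2 by rewrite gtr_pMr // gtrBl.
  have d4 : 0 < 2 * (1 - d) by rewrite mulr_gt0.
  have d5 : - 2 < 0 :> C by rewrite oppr_lt0.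
  rewrite /w; case: hD => ->; first by rewrite (lt_trans d5 d4) d3.
  by rewrite mulNr ltrN2 d3 (lt_trans _ (lt_trans d4 d3)) // oppr_lt0.
pose q := t - w *: 'X^(p./2).
have sw : (size (w *: 'X^(p./2) : {poly C})%R < p.+1)%N.
  by rewrite (leq_ltn_trans (size_scale_leq _ _)) // size_polyXn.
have sq : size q = p.+1 by rewrite size_polyDl size_trace // size_polyN.
have lq : lead_coef q = leading alpha p.
  by rewrite lead_coefDl ?lead_coef_trace // size_trace // size_polyN.
have [||x qx zx] := @root_close _ q z e _ e0.
- by rewrite -size_poly_gt0 sq.
- rewrite lq sq /= (gtr0_norm (leading_gt0 _ ha)) -/A.
  rewrite hornerD hornerN hornerZ hornerXn trace_Delta // -/w0.
  rewrite (_ : _ - _ = w0 * d * z ^+ p./2); last by rewrite /w; ring.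
  rewrite (normrM (w0 * d)) (normrM w0) normrX w02 (gtr0_norm d0) mulrAC -/B /d.
  by rewrite mulrA ltr_pdivrMr // mulrC ltr_pM2l // ltrDr.
have x0 : x != 0.
  apply: contra_eq_neq qx => ->.
  rewrite hornerD hornerN hornerZ hornerXn trace_at0 // expr0n gtn_eqF //=.
  by rewrite mulr0 subr0 gt_eqF ?leading_gt0.
exists x; split; last exact: hU.
split=> //; suff -> : Delta alpha p x = w by [].
have xh : x ^+ p./2 != 0 by rewrite expf_neq0.
apply: (mulfI xh); rewrite -trace_Delta // mulrC.
by move: qx => /eqP; rewrite hornerD hornerN hornerZ hornerXn subr_eq0 => /eqP.
Qed.

Lemma off_bands_split z : ~ bands alpha p z -> split_point z.
Proof.
apply: contra_notP => /negP; rewrite /split_point -real_leNgt ?normr_real // => le12.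
have l12 : `|l2 z| = `|l1 z|.
  by apply/eqP; rewrite eq_le lambda_norm.
have z0 : z != 0.
  apply: contra_eq_neq l12 => ->; rewrite lambda2_0 // lambda1_0 // normr0.
  by rewrite eq_sym normr_eq0 gt_eqF ?leading_gt0.
have := @unit_circle_Delta _ alpha p z.
move: l12; rewrite lambda1E // lambda2E // !normrM => /(mulfI _) -> //; last first.
  by rewrite normr_eq0 expf_neq0.
move=> /(_ erefl) /andP[]; rewrite !le_eqVlt => /orP[/eqP D1 _|D1].
  by apply: band_edge => //; right.
case/orP=> [/eqP D2|D2]; first by apply: band_edge => //; left.
by apply: subset_closure; rewrite /= D1 D2.
Qed.

(** The eigenvalues at [z] are the roots of a polynomial whose value at
    [l1 z0] is small when [z] is close to [z0], so one of them is close to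
    [l1 z0]; the trace puts the other close to [l2 z0], and the gap between
    the moduli at [z0] tells which is which. *)
Lemma near_lambda1 z0 e : split_point z0 -> 0 < e ->
  \forall z \near z0, `|l1 z - l1 z0| < e /\ split_point z.
Proof.
move=> s0 e0; have g0 : 0 < (`|l1 z0| - `|l2 z0|) / 4.
  by rewrite divr_gt0 // subr_gt0.
have [d [d0 de dg]] := common_lower_bound e0 g0.
(* The characteristic polynomial at [z], evaluated at the fixed [l1 z0]. *)
pose q := (l1 z0 ^+ 2)%:P - l1 z0 *: t + 'X^p.
have qE z : q.[z] = (l1 z0 - l1 z) * (l1 z0 - l2 z).
  rewrite hornerD hornerXn hornerD hornerN hornerC hornerZ -(lambda_sum alpha p).
  by rewrite -(lambda_prod ha p_gt0 p_even); ring.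
have q0 : q.[z0] = 0 by rewrite qE subrr mul0r.
have dd : 0 < d ^+ 2 by rewrite exprn_gt0.
near=> z.
have tz : `|t.[z] - t.[z0]| < d by near: z; exact: near_horner.
have : `|q.[z]| < d ^+ 2.
  by rewrite -[q.[z]]subr0 -q0; near: z; exact: near_horner.
rewrite qE normrM => prod_small.
have key l m : l + m = t.[z] -> l * m = z ^+ p -> `|l1 z0 - l| < d ->
    `|l1 z - l1 z0| < e /\ split_point z.
  move=> lm1 lm2 ld.
  have ml : `|m| < `|l|.
    have m1 : `|m| < `|l2 z0| + (d + d).
      have -> : m = l2 z0 + ((t.[z] - t.[z0]) + (l1 z0 - l)).
        by rewrite -lm1 -lambda_sum; ring.
      apply: le_lt_trans (ler_normD _ _) _; rewrite ltrD2l.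
      by apply: le_lt_trans (ler_normD _ _) _; rewrite ltrD.
    have l3 : `|l1 z0| - d < `|l|.
      have := lerB_dist (l1 z0) l; rewrite lerBlDr => h.
      by rewrite ltrBlDr (le_lt_trans h) // addrC ltrD2l.
    apply: lt_trans m1 (le_lt_trans _ l3).
    rewrite lerBrDr -addrA addrC -lerBrDr.
    apply: le_trans (_ : d * 4 <= _); last by rewrite -ler_pdivlMr.
    rewrite (_ : d * 4 = d + d + d + d); last by ring.
    by rewrite lerDl ltW.
  have [E1 E2] := lambda_unique ha p_gt0 p_even lm1 lm2 ml.
  split; last by rewrite /split_point E1 E2.
  by rewrite E1 distrC (lt_le_trans ld).
have [h|h] := real_ltP (normr_real (l1 z0 - l1 z)) (gtr0_real d0).
  apply: (key (l1 z) (l2 z)) => //; [exact: lambda_sum|exact: lambda_prod].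
apply: (key (l2 z) (l1 z)).
- by rewrite addrC; exact: lambda_sum.
- by rewrite mulrC; exact: lambda_prod.
rewrite real_ltNge ?normr_real ?gtr0_real //; apply/negP => h'.
by move: prod_small; rewrite le_gtF // expr2 ler_pM // ltW.
Unshelve. all: by end_near.
Qed.

Lemma near_split z0 : split_point z0 -> \forall z \near z0, split_point z.
Proof. by move=> s0; apply: filterS (near_lambda1 s0 ltr01) => z []. Qed.

Lemma cvg_lambda1 z0 : split_point z0 -> l1 z @[z --> z0] --> l1 z0.
Proof.
move=> s0; apply/cvgrPdistC_lt => e e0.
by apply: filterS (near_lambda1 s0 e0) => z [].
Qed.

Lemma cvg_lambda2 z0 : split_point z0 -> l2 z @[z --> z0] --> l2 z0.
Proof. by move=> s0; apply: cvgB; [exact: cvg_horner|exact: cvg_lambda1]. Qed.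

End OffBands.

(** * The spectral projection and the powers of the transfer matrix *)

Section Projection.
Variable C : numClosedFieldType.
Variables (alpha : nat -> C) (p : nat).
Hypothesis ha : in_disc alpha.
Hypothesis per : forall n, alpha (n + p)%N = alpha n.
Hypothesis p_gt0 : (0 < p)%N.
Hypothesis p_even : ~~ odd p.
Implicit Types (z w : C) (m n b : nat).

Notation t := (trace_poly alpha p).
Notation l1 := (lambda1 alpha p).
Notation l2 := (lambda2 alpha p).
Notation split_point := (split_point alpha p).

Lemma split_point0 : split_point 0.
Proof.
by rewrite /split_point lambda2_0 lambda1_0 // normr0 normr_gt0 gt_eqF ?leading_gt0.
Qed.

(** Away from 0 nothing is extended, and at 0 the extension is the value of any
    continuous function with the same values elsewhere. *)
Lemma ext0_cvg (f g : C -> C) : (forall w, w != 0 -> f w = g w) ->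
  g w @[w --> (0 : C)] --> g 0 -> ext0 f =1 g.
Proof.
move=> fg cg z; rewrite /ext0; have [->|z0] := eqVneq z 0; last exact: fg.
apply: cvg_lim; first exact: norm_hausdorff.
apply: cvg_trans (cvg_trans (cvg_fmap2 (@nbhs_dnbhs _ (0 : C))) cg).
apply: near_eq_cvg; near=> w; rewrite fg //; near: w; exact: nbhs_dnbhs_neq.
Unshelve. all: by end_near.
Qed.

Lemma transfer_entry (i j : 'I_2) : exists q : {poly C},
  forall z, transfer alpha p z i j = q.[z].
Proof.
exists (nth [::] [:: [:: tr11 alpha p; tr12 alpha p]; [:: tr21 alpha p; tr22 alpha p]] i)`_j.
move=> z; rewrite transferE // mxE.
by case: i => -[|[|]] // hi; case: j => -[|[|]].
Qed.

Definition projection z : 'M[C]_2 :=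
  (l1 z - l2 z)^-1 *: (transfer alpha p z - (l2 z)%:M).

Lemma PplusE z : Pplus alpha p z = projection z.
Proof.
apply/matrixP => i j; rewrite mxE.
apply: (@ext0_cvg _ (fun w => projection w i j)) => [w w0|].
  have wh : w ^+ p./2 != 0 by rewrite expf_neq0.
  rewrite /projection lambda1E // lambda2E // -mulrBr invfM /Pplus0.
  rewrite !mxE -mulrA mulrCA; congr (_ * _).
  by rewrite mulrBr -mulrnAr mulrA mulVf // mul1r.
have [q hq] := transfer_entry i j.
pose F w := (l1 w - l2 w)^-1 * (q.[w] - l2 w * (i == j)%:R).
have -> : (fun w => projection w i j) = F.
  by apply/funext => w; rewrite !mxE hq /F mulr_natr.
rewrite (_ : projection 0 i j = F 0); last by rewrite !mxE hq /F mulr_natr.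
rewrite /F.
have s0 := split_point0.
have c1 := cvg_lambda1 ha p_gt0 p_even s0.
have c2 := cvg_lambda2 ha p_gt0 p_even s0.
apply: cvgM; first by apply: cvgV; [exact: lambda_gap_neq0|exact: cvgB].
apply: cvgB; first exact: cvg_horner.
by apply: cvgM => //; exact: cvg_cst.
Qed.

Lemma prefactorE m z : prefactor alpha p m z = l1 z ^- m.
Proof.
apply: (@ext0_cvg _ (fun w => l1 w ^- m)) => [w w0|].
  rewrite -{1}(double_half p_even) addnn -muln2 mulnA muln2 doubleK.
  by rewrite lambda1E // mulnC exprM -invfM -exprMn.
have s0 := split_point0.
have c1 := cvg_lambda1 ha p_gt0 p_even s0.
apply: cvgV; first by rewrite expf_neq0 // lambda1_neq0.
have -> : (fun w => l1 w ^+ m) = (fun w => ('X^m : {poly C}).[l1 w]).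
  by apply/funext => w; rewrite hornerXn.
rewrite -(hornerXn (l1 0)).
exact: (cvg_comp _ _ c1 (@cvg_horner _ _ _)).
Qed.

(** Up to the factor [l1 z - l2 z], the component along the eigenvalue [l1 z] of
    the sequence of the [(phi alpha (m * p + b)).[z]]. *)
Definition dominant_part b z := (phi alpha (b + p)).[z] - l2 z * (phi alpha b).[z].

Lemma j_funE b z : j_fun alpha p b z = dominant_part b z / (l1 z - l2 z).
Proof.
set s := (l1 z - l2 z)^-1.
pose x := s * ((phi alpha p).[z] - l2 z).
pose y := s * ((star_poly p (phi alpha p)).[z] - l2 z).
have PE : Pplus alpha p z *m col2 1 1 = col2 x y.
  rewrite PplusE /projection transferE //; apply/matrixP => i k.
  rewrite !mxE !big_ord_recl big_ord0 addr0 !mxE -/s /x /y.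
  rewrite star_phi_tr phi_tr !hornerD.
  by case: i => -[|[|]] // hi /=; ring.
have E1 : inner (col2 1 1) (col2 x y) = x + y.
  by rewrite /inner !big_ord_recl big_ord0 addr0 !mxE /= conjC1 !mul1r.
have E2 : inner (col2 1 (-1)) (col2 x y) = x - y.
  by rewrite /inner !big_ord_recl big_ord0 addr0 !mxE /= rmorphN /= conjC1; ring.
rewrite /j_fun /a_fun /b_fun PE E1 E2.
transitivity (x * (tr11 alpha b).[z] + y * (tr12 alpha b).[z]).
  by rewrite /tr11 /tr12 !hornerZ !hornerD hornerN; field.
by rewrite /x /y /dominant_part phi_period // (phi_tr alpha b) hornerD -/s; ring.
Qed.

(** The Lucas sequence of the trace and the determinant. These polynomials grow
    like the powers of [lambda1] and have no zeros near a split point for large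
    [m]: they stand for the powers of [lambda1], which is only algebraic, in the
    comparison of zeros. *)
Fixpoint lucas m : {poly C} :=
  match m with
  | 0 => 0
  | m'.+1 => match m' with
    | 0 => 1
    | m''.+1 => t * lucas m' - 'X^p * lucas m''
    end
  end.

Lemma lucasSS m : lucas m.+2 = t * lucas m.+1 - 'X^p * lucas m.
Proof. by []. Qed.

Lemma lucas_step m z :
  (lucas m.+1).[z] = l2 z * (lucas m).[z] + l1 z ^+ m.
Proof.
elim: m => [|m IH]; first by rewrite /= horner0 mulr0 add0r hornerE.
rewrite lucasSS hornerD hornerN !hornerM hornerXn.
rewrite -(lambda_sum alpha p) -(lambda_prod ha p_gt0 p_even) IH exprS; ring.
Qed.

Lemma lucasE m z :
  (l1 z - l2 z) * (lucas m).[z] = l1 z ^+ m - l2 z ^+ m.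
Proof.
elim: m => [|m IH]; first by rewrite /= horner0 mulr0 subrr.
rewrite lucas_step mulrDr mulrCA IH !exprS; ring.
Qed.

Lemma phi_step m b z : (phi alpha (m.+1 * p + b)).[z] =
  l2 z * (phi alpha (m * p + b)).[z] + l1 z ^+ m * dominant_part b z.
Proof.
elim: m => [|m IH].
  by rewrite mul1n mul0n expr0 mul1r /dominant_part addnC add0n addrC subrK.
have -> : (m.+2 * p + b = m * p + b + p + p)%N by rewrite !mulSn; lia.
have E : (m.+1 * p + b = m * p + b + p)%N by rewrite mulSn; lia.
rewrite phi_rec // -E IH -(lambda_sum alpha p) -(lambda_prod ha p_gt0 p_even).
rewrite exprS; ring.
Qed.

Lemma phi_lucas m b z : (phi alpha (m * p + b)).[z] =
  (lucas m).[z] * dominant_part b z + l2 z ^+ m * (phi alpha b).[z].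
Proof.
elim: m => [|m IH]; first by rewrite mul0n add0n /= horner0 mul0r add0r expr0 mul1r.
rewrite phi_step IH lucas_step exprS; ring.
Qed.

Lemma phi_normalized m b z : split_point z ->
  l1 z ^- m * (phi alpha (m * p + b)).[z] =
  j_fun alpha p b z + (l2 z / l1 z) ^+ m * ((phi alpha b).[z] - j_fun alpha p b z).
Proof.
move=> sz; have g0 := lambda_gap_neq0 sz; have l0 := lambda1_neq0 sz.
rewrite phi_lucas j_funE expr_div_n.
have -> : (lucas m).[z] = (l1 z ^+ m - l2 z ^+ m) / (l1 z - l2 z).
  by rewrite -lucasE mulrAC divff // mul1r.
by field; rewrite g0 expf_neq0.
Qed.

(** The eliminant is the norm of [dominant_part] for the quadratic extension
    generated by the eigenvalues. *)
Lemma eliminantE b z : (eliminant alpha p b).[z] =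
  dominant_part b z * ((phi alpha (b + p)).[z] - l1 z * (phi alpha b).[z]).
Proof.
rewrite /eliminant /dominant_part hornerD !hornerM hornerD hornerN hornerM.
rewrite hornerXn -(lambda_sum alpha p) -(lambda_prod ha p_gt0 p_even).
ring.
Qed.

Lemma j_fun_eliminant b z : split_point z -> j_fun alpha p b z = 0 ->
  (eliminant alpha p b).[z] = 0.
Proof.
move=> /lambda_gap_neq0 g0; rewrite j_funE => /eqP.
by rewrite mulf_eq0 invr_eq0 (negPf g0) orbF eliminantE => /eqP ->; rewrite mul0r.
Qed.

Lemma cvg_phi_normalized b z
    (archi : forall x : C, exists n : nat, `|x| < n%:R) : split_point z ->
  prefactor alpha p m z * (phi alpha (m * p + b)).[z] @[m --> \oo] -->
    j_fun alpha p b z.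
Proof.
move=> sz; set K := (phi alpha b).[z] - j_fun alpha p b z.
apply/cvgrPdistC_lt => e e0.
have s1 : 0 <= `|l2 z / l1 z| < 1.
  by rewrite normr_ge0 normf_div ltr_pdivrMr ?mul1r // (le_lt_trans _ sz).
have K0 : 0 < `|K| + 1 by rewrite ltr_wpDl.
have [M hM] := pow_small archi s1 (divr_gt0 e0 K0).
exists M => // m /= Mm; rewrite prefactorE phi_normalized // addrC addKr.
rewrite normrM normrX; have := hM _ Mm; rewrite ltr_pdivlMr //.
by apply: le_lt_trans; rewrite ler_wpM2l ?exprn_ge0 // lerDl.
Qed.

End Projection.

(** * Polynomials near infinity *)

Section Growth.
Variable C : numClosedFieldType.
Implicit Types (q : {poly C}) (z : C) (n : nat).

Lemma horner_upper q n : (size q <= n.+1)%N ->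
  exists2 B, 0 <= B & forall z, 1 <= `|z| -> `|q.[z]| <= B * `|z| ^+ n.
Proof.
move=> sq; exists (\sum_(i < n.+1) `|q`_i|) => [|z z1]; first exact: sumr_ge0.
rewrite (horner_coef_wide _ sq) mulr_suml; apply: le_trans (ler_norm_sum _ _ _) _.
apply: ler_sum => i _; rewrite normrM normrX ler_wpM2l //.
by rewrite ler_weXn2l // -ltnS.
Qed.

Lemma horner_dominated q1 q2 (A : C) : 0 <= A -> (size q1 < size q2)%N ->
  exists2 r, 0 < r & forall z, r < `|z| -> A * `|q1.[z]| < `|q2.[z]|.
Proof.
move=> A0 s12; have q20 : q2 != 0 by rewrite -size_poly_gt0 (leq_ltn_trans _ s12).
have lc0 : 0 < `|lead_coef q2| by rewrite normr_gt0 lead_coef_eq0.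
case Dn : (size q2) s12 => [|[|n]] //; rewrite ltnS => s1.
  exists 1 => // z _; move: s1; rewrite leqn0 size_poly_eq0 => /eqP ->.
  rewrite horner0 normr0 mulr0 normr_gt0.
  move/eqP: Dn => /size_poly1P[c c0 ->]; by rewrite hornerC.
have [B1 B10 h1] := horner_upper s1.
pose q3 := q2 - lead_coef q2 *: 'X^(n.+1).
have s3 : (size q3 <= n.+1)%N.
  apply/leq_sizeP => i; rewrite coefB coefZ coefXn leq_eqVlt => /orP[/eqP <-|ni].
    by rewrite eqxx mulr1 lead_coefE Dn subrr.
  by rewrite (gtn_eqF ni) mulr0 subr0 nth_default // Dn.
have [B2 B20 h2] := horner_upper s3.
exists (1 + (A * B1 + B2) / `|lead_coef q2|) => [|z rz].
  by rewrite ltr_wpDr // divr_ge0 // addr_ge0 // mulr_ge0.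
have z1 : 1 <= `|z|.
  by apply: ltW; apply: le_lt_trans rz; rewrite lerDl divr_ge0 // addr_ge0 // mulr_ge0.
have zn : 0 < `|z| ^+ n by rewrite exprn_gt0 // (lt_le_trans ltr01).
have big : A * B1 + B2 < `|lead_coef q2| * `|z|.
  by rewrite [ltRHS]mulrC -ltr_pdivrMr //; apply: lt_trans rz; rewrite ltrDr.
have lower : `|lead_coef q2| * `|z| ^+ n.+1 - B2 * `|z| ^+ n <= `|q2.[z]|.
  have -> : q2.[z] = lead_coef q2 * z ^+ n.+1 + q3.[z].
    by rewrite hornerD hornerN hornerZ hornerXn addrC subrK.
  rewrite lerBlDr; apply: le_trans (lerD (lexx _) (h2 _ z1)).
  by rewrite -normrX -normrM -{1}[_ * z ^+ _](addrK q3.[z]) ler_normB.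
apply: lt_le_trans lower; apply: le_lt_trans (ler_wpM2l A0 (h1 _ z1)) _.
by rewrite ltrBrDr mulrA -mulrDl exprS mulrA ltr_pM2r.
Qed.
End Growth.

Lemma card_le_seq (T : eqType) (s : seq T) n : (size s <= n)%N -> [set` s] #<= `I_n.
Proof.
move=> sn; have inj : {in [set` s] &, injective (fun x => index x s)}.
  by move=> x y /set_mem /= xs /set_mem /= ys; apply: index_inj.
rewrite -(card_le_eql (inj_card_eq inj)); apply: subset_card_le => _ [x /= xs <-].
by rewrite (leq_trans _ sn) // index_mem.
Qed.

(** * Zeros of the limit function and of the orthonormal polynomials *)

Section Zeros.
Variable C : numClosedFieldType.
Hypothesis archi : forall x : C, exists n : nat, `|x| < n%:R.
Variables (alpha : nat -> C) (p : nat).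
Hypothesis ha : in_disc alpha.
Hypothesis per : forall n, alpha (n + p)%N = alpha n.
Hypothesis p_gt0 : (0 < p)%N.
Hypothesis p_even : ~~ odd p.
Implicit Types (z w : C) (m n b : nat).

Notation t := (trace_poly alpha p).
Notation l1 := (lambda1 alpha p).
Notation l2 := (lambda2 alpha p).
Notation split_point := (split_point alpha p).

(** The eigenvalue [l2 z] stays bounded as [z] grows, for [l1 z] grows like the
    trace and their product is [z ^+ p]; hence [phi alpha (b + p)] dominates
    the other term of [dominant_part]. *)
Lemma j_fun_infinity b : exists r : C, 0 < r /\
  forall z, r < `|z| -> j_fun alpha p b z != 0.
Proof.
have s1 : (size ('X^p : {poly C}) < size (t ^+ 2))%N.
  rewrite size_polyXn expr2 size_mul ?trace_neq0 // size_trace //=.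
  by lia.
have s2 : (size ('X^p * phi alpha b)%R < size (phi alpha (b + p) * t)%R)%N.
  rewrite !size_mul ?phi_neq0 ?trace_neq0 ?(monic_neq0 (monicXn _ _)) //.
  by rewrite size_polyXn !size_phi // size_trace //=; lia.
have [r1 r10 h1] := horner_dominated (ler0n C 4) s1.
have [r2 r20 h2] := horner_dominated (ler0n C 2) s2.
exists (r1 + r2); split=> [|z rz]; first exact: addr_gt0.
have {}h1 := h1 z (lt_trans _ rz); have {}h2 := h2 z (lt_trans _ rz).
rewrite ltrDl in h1; rewrite ltrDr in h2; move: (h1 r20) (h2 r10).
rewrite !hornerM hornerXn -(lambda_prod ha p_gt0 p_even) !normrM => d1 d2.
have tle : `|t.[z]| <= 2 * `|l1 z|.
  rewrite -(lambda_sum alpha p) mulrDl mul1r (le_trans (ler_normD _ _)) // lerD2l.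
  exact: lambda_norm.
have sz : split_point z.
  rewrite /split_point real_ltNge ?normr_real //; apply/negP => l12.
  move: d1; rewrite le_gtF //.
  apply: le_trans (ler_pM _ _ tle tle) _ => //.
  rewrite [leLHS](_ : _ = 4 * (`|l1 z| * `|l1 z|)); last by ring.
  by rewrite !ler_wpM2l.
apply/eqP => j0; move: d2; rewrite le_gtF //.
have : dominant_part alpha p b z = 0.
  by apply/eqP; move/eqP: j0; rewrite j_funE // mulf_eq0 invr_eq0 (negPf (lambda_gap_neq0 sz)) orbF.
move/eqP; rewrite subr_eq0 => /eqP ->; rewrite normrM.
rewrite [leRHS](_ : _ = `|l2 z| * `|(phi alpha b).[z]| * (2 * `|l1 z|)); last by ring.
by rewrite ler_wpM2l // mulr_ge0.
Qed.

Lemma card_zeros_j_fun b : (exists n, alpha n != 0) ->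
  [set z | ~ bands alpha p z /\ j_fun alpha p b z = 0] #<= `I_(2 * p + 2 * b - 1).
Proof.
move=> an; have e0 := eliminant_neq0 ha per p_gt0 b an.
set s := zeros (eliminant alpha p b).
have sub : [set z | ~ bands alpha p z /\ j_fun alpha p b z = 0] `<=` [set` s].
  move=> z [/(off_bands_split ha p_gt0 p_even) sz jz] /=.
  by rewrite mem_zerosE // (j_fun_eliminant ha per p_gt0 p_even sz jz).
apply: card_le_trans (subset_card_le sub) (card_le_seq _).
by rewrite size_zeros // -subn1 leq_sub2r // size_eliminant.
Qed.

(** Near [z0] the polynomial [phi alpha (m * p + b)] is [lucas m] times
    [dominant_part], up to an error that is exponentially smaller, and
    [dominant_part] is close to [c * (z - z0) ^+ K]. So Rouche's theorem
    compares two genuine polynomials, [phi alpha (m * p + b)] and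
    [c *: ('X - z0%:P) ^+ K * lucas m], and the second has no zero nearby
    other than [z0]. Allowing [K = 0] covers the points where the limit does not
    vanish. *)
Lemma zeros_phi_near b z0 K (g : C -> C) : split_point z0 ->
  g z @[z --> z0] --> g z0 -> g z0 != 0 ->
  (\forall z \near z0, j_fun alpha p b z = (z - z0) ^+ K * g z) ->
  exists eps : C, 0 < eps /\ exists M : nat, forall m, (M <= m)%N ->
    count (fun z => `|z - z0| < eps) (zeros (phi alpha (m * p + b))) = K.
Proof.
move=> s0 cg g0 jg.
have c1 := cvg_lambda1 ha p_gt0 p_even s0; have c2 := cvg_lambda2 ha p_gt0 p_even s0.
pose S z := l1 z - l2 z; pose h z := S z * g z; pose c := h z0.
have S0 : S z0 != 0 := lambda_gap_neq0 s0.
have c0 : c != 0 by rewrite mulf_neq0.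
have cS : S z @[z --> z0] --> S z0 by apply: cvgB.
have ch : h z @[z --> z0] --> h z0 by apply: cvgM.
have cq : l2 z / l1 z @[z --> z0] --> l2 z0 / l1 z0.
  by apply: cvgM => //; apply: cvgV => //; exact: lambda1_neq0.
pose sg0 := `|l2 z0 / l1 z0|.
have sg01 : sg0 < 1 by rewrite /sg0 normf_div ltr_pdivrMr ?mul1r // (le_lt_trans _ s0).
(* Strictly between the ratio of the moduli at [z0] and 1, hence a bound for
   the ratio near [z0]. *)
pose sg := (sg0 + 1) / 2.
have sg1 : sg < 1 by rewrite /sg ltr_pdivrMr // mul1r -[ltRHS]/(1 + 1) ltrD2r.
have sg_ge0 : 0 <= sg by rewrite divr_ge0 ?addr_ge0 ?ler01 // /sg0.
have e1 : 0 < (1 - sg0) / 2 by rewrite divr_gt0 // subr_gt0.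
have e2 : 0 < `|c| / 4 by rewrite divr_gt0 // normr_gt0.
pose B := `|(phi alpha b).[z0]| + 1; pose D := `|S z0| + 1.
have B0 : 0 < B by rewrite ltr_wpDl.
have D0 : 0 < D by rewrite ltr_wpDl.
have /nbhs_normP[e /= e0 he] : \forall z \near z0,
    [/\ j_fun alpha p b z = (z - z0) ^+ K * g z, `|h z - c| <= `|c| / 4,
        `|l2 z| <= sg * `|l1 z|, `|(phi alpha b).[z]| <= B & `|S z| <= D]
    /\ split_point z.
  have dist1 (x y e : C) : `|x - y| < e -> `|x| <= `|y| + e.
    move=> xy; rewrite -[x](subrK y) addrC (le_trans (ler_normD _ _)) // lerD2l.
    exact: ltW.
  near=> z.
  have sz : split_point z by near: z; exact: near_split.
  split=> //; split.
  - by near: z.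
  - by apply: ltW; near: z; move/cvgrPdistC_lt: ch; apply.
  - have : `|l2 z / l1 z - l2 z0 / l1 z0| < (1 - sg0) / 2.
      by near: z; move/cvgrPdistC_lt: cq; apply.
    move/dist1; rewrite normf_div -/sg0 ler_pdivrMr ?(le_lt_trans _ sz) //.
    by rewrite (_ : sg0 + _ = sg) // /sg; field.
  - by apply: dist1; near: z; exact: near_horner.
  - by apply: dist1; near: z; move/cvgrPdistC_lt: cS; apply.
pose r := e / 8.
have r0 : 0 < r by rewrite divr_gt0.
have re : 4 * r < e.
  by rewrite (_ : 4 * r = e / 2); [rewrite ltr_pdivrMr // ltr_pMr // ltr1n|rewrite /r; field].
exists (4 * r); split; first exact: mulr_gt0.
(* [r] is the inner radius of the annulus, where the comparison polynomial is
   smallest; this threshold for [sg ^+ m] makes the error at most a quarter of it. *)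
have T0 : 0 < (1 - sg) * (`|c| / 4) * r ^+ K / (B * D).
  by rewrite divr_gt0 ?(mulr_gt0 B0 D0) // mulr_gt0 ?exprn_gt0 // mulr_gt0 ?subr_gt0.
have [|M hM] := pow_small archi (_ : 0 <= sg < 1) T0; first by rewrite sg_ge0.
exists M.+1 => m Mm; have {}hM := hM m (ltnW Mm).
have m0 : (0 < m)%N by apply: leq_trans Mm.
rewrite ltr_pdivlMr ?mulr_gt0 // in hM.
pose u := lucas alpha p m.
have u_lower z : `|z0 - z| < e -> (1 - sg) * `|l1 z| ^+ m <= `|S z| * `|u.[z]|.
  move=> /he[[_ _ l21 _ _] sz]; rewrite -normrM lucasE //.
  apply: le_trans (_ : `|l1 z| ^+ m - `|l2 z| ^+ m <= _); last first.
    by rewrite -!normrX lerB_dist.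
  rewrite mulrBl mul1r lerD2l lerN2.
  apply: le_trans (_ : (sg * `|l1 z|) ^+ m <= _).
    by rewrite lerXn2r // nnegrE mulr_ge0.
  rewrite exprMn ler_wpM2r ?exprn_ge0 // -{2}[sg]expr1 ler_wiXn2l //.
  exact: ltW.
have u_neq0 z : `|z0 - z| < e -> u.[z] != 0.
  move=> ze; have [_ sz] := he _ ze; have := u_lower _ ze.
  apply: contraTneq => ->; rewrite normr0 mulr0 lt_geF // mulr_gt0 ?subr_gt0 //.
  by rewrite exprn_gt0 // normr_gt0 lambda1_neq0.
have u0 : u != 0.
  apply: contraNneq (u_neq0 z0 _) => [->|]; first by rewrite horner0.
  by rewrite subrr normr0.
have lu0 : c * lead_coef u != 0 by rewrite mulf_neq0 ?lead_coef_eq0.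
have lphi0 : lead_coef (phi alpha (m * p + b)) != 0 by rewrite lead_coef_eq0 phi_neq0.
have wE z : factored (c * lead_coef u) (nseq K z0 ++ zeros u) z =
    c * (z - z0) ^+ K * u.[z].
  rewrite /factored big_cat /= horner_zeros big_nseq iter_mulr_1.
  by ring.
rewrite (@rouche_factored _ archi _ _ _ (nseq K z0 ++ zeros u) z0 r r0 lphi0 lu0).
  rewrite count_cat count_nseq subrr normr0 mulr_gt0 // mul1n.
  rewrite (_ : count _ (zeros u) = 0%N) ?addn0 //; apply/eqP.
  rewrite -leqn0 leqNgt -has_count; apply/hasPn => x /mem_zeros ux.
  by apply: contra_eqN ux => xr; rewrite u_neq0 // distrC (lt_trans xr).
move=> z /andP[rz zr]; rewrite wE.
have ze : `|z0 - z| < e by rewrite distrC (le_lt_trans zr).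
have [[jz hz l21 Bz Dz] sz] := he _ ze.
have z_neq : z - z0 != 0 by rewrite -normr_gt0 (lt_le_trans r0).
split; first by rewrite !mulf_neq0 ?expf_neq0 ?u_neq0.
rewrite -[factored _ _ z]horner_zeros phi_lucas // -/u.
have -> : dominant_part alpha p b z = (z - z0) ^+ K * h z.
  rewrite /h mulrCA -jz j_funE // mulrCA divff ?mulr1 //.
  exact: lambda_gap_neq0.
rewrite (_ : _ - _ = (z - z0) ^+ K * u.[z] * (h z - c) + l2 z ^+ m * (phi alpha b).[z]);
  last by ring.
apply: le_trans (ler_normD _ _) _.
set W := `|c * _ * _|.
have WE : W = `|c| * (`|z - z0| ^+ K * `|u.[z]|) by rewrite /W !normrM normrX mulrA.
have -> : W / 2 = W / 4 + W / 4 by field.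
apply: lerD.
  rewrite !normrM normrX WE.
  rewrite [leRHS](_ : _ = `|z - z0| ^+ K * `|u.[z]| * (`|c| / 4)); last by ring.
  by rewrite ler_wpM2l // mulr_ge0 // exprn_ge0.
have s10 : 0 < 1 - sg by rewrite subr_gt0.
rewrite -(ler_pM2l s10) normrM normrX.
apply: le_trans (_ : (1 - sg) * ((sg * `|l1 z|) ^+ m * B) <= _).
  rewrite ler_wpM2l ?(ltW s10) // ler_pM ?exprn_ge0 ?normr_ge0 //.
  by rewrite lerXn2r // nnegrE mulr_ge0.
apply: le_trans (_ : sg ^+ m * (B * D) * `|u.[z]| <= _).
  rewrite exprMn [leLHS](_ : _ = sg ^+ m * B * ((1 - sg) * `|l1 z| ^+ m)); last by ring.
  rewrite [leRHS](_ : _ = sg ^+ m * B * (D * `|u.[z]|)); last by ring.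
  rewrite ler_wpM2l ?mulr_ge0 ?exprn_ge0 ?(ltW B0) //.
  by apply: le_trans (u_lower _ ze) _; rewrite ler_wpM2r.
apply: le_trans (_ : (1 - sg) * (`|c| / 4) * r ^+ K * `|u.[z]| <= _).
  by rewrite ler_wpM2r // ltW.
rewrite WE.
rewrite [leRHS](_ : _ = (1 - sg) * (`|c| / 4) * `|z - z0| ^+ K * `|u.[z]|);
  last by ring.
rewrite ler_wpM2r // ler_wpM2l ?(ltW (mulr_gt0 s10 e2)) //.
by rewrite lerXn2r // nnegrE ltW.
Unshelve. all: by end_near.
Qed.

End Zeros.

Section Continuity.
Variable C : numClosedFieldType.
Variables (alpha : nat -> C) (p : nat).
Hypothesis ha : in_disc alpha.
Hypothesis per : forall n, alpha (n + p)%N = alpha n.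
Hypothesis p_gt0 : (0 < p)%N.
Hypothesis p_even : ~~ odd p.

Lemma cvg_j_fun b z0 : split_point alpha p z0 ->
  j_fun alpha p b z @[z --> z0] --> j_fun alpha p b z0.
Proof.
move=> s0; have c1 := cvg_lambda1 ha p_gt0 p_even s0.
have c2 := cvg_lambda2 ha p_gt0 p_even s0.
rewrite j_funE // (_ : j_fun alpha p b = fun z =>
  dominant_part alpha p b z / (lambda1 alpha p z - lambda2 alpha p z)); last first.
  by apply/funext => z; rewrite j_funE.
apply: cvgM; last by apply: cvgV; [exact: lambda_gap_neq0|exact: cvgB].
apply: cvgB; first exact: cvg_horner.
by apply: cvgM => //; exact: cvg_horner.
Qed.

Lemma zeros_phi_order b z0 k
    (archi : forall x : C, exists n : nat, `|x| < n%:R) :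
  split_point alpha p z0 -> zero_of_order (j_fun alpha p b) z0 k ->
  exists eps : C, 0 < eps /\ exists M : nat, forall m : nat, (M <= m)%N ->
    count (fun z => `|z - z0| < eps) (zeros (phi alpha (m * p + b))) = k.
Proof.
move=> s0 [_ [g [dg g0 jg]]].
apply: (zeros_phi_near archi ha per p_gt0 p_even s0 _ g0 jg).
apply: differentiable_continuous; apply/derivable1_diffP.
exact: nbhs_singleton dg.
Qed.

Lemma phi_neq0_near b z0
    (archi : forall x : C, exists n : nat, `|x| < n%:R) :
  split_point alpha p z0 -> j_fun alpha p b z0 != 0 ->
  exists eps : C, 0 < eps /\ exists M : nat, forall z m,
    `|z - z0| < eps -> (M <= m)%N -> (phi alpha (m * p + b)).[z] != 0.
Proof.
move=> s0 j0; have j_factor : \forall z \near z0,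
    j_fun alpha p b z = (z - z0) ^+ 0 * j_fun alpha p b z.
  by near=> z; rewrite expr0 mul1r.
have [eps [e0 [M hM]]] := zeros_phi_near archi ha per p_gt0 p_even s0
  (@cvg_j_fun b _ s0) j0 j_factor.
exists eps; split=> //; exists M => z m ze Mm.
rewrite -mem_zerosE ?phi_neq0 //; apply/negP => zm.
have := hM m Mm; apply/eqP; rewrite -lt0n -has_count.
by apply/hasP; exists z.
Unshelve. all: by end_near.
Qed.
End Continuity.

Lemma cplx_archimedean (R : realType) (x : cplx R) : exists n : nat, `|x| < n%:R.
Proof.
rewrite normc_def; set y := Num.sqrt _; exists (Num.bound y).
have -> : (Num.bound y)%:R = ((Num.bound y)%:R : R)%:C%C :> R[i].
  by rewrite rmorph_nat.
by rewrite ltcR archi_boundP // sqrtr_ge0.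
Qed.

Unset Implicit Arguments.

Theorem theorem3p2 (R : realType) (p : nat) (hp2 : (2 <= p)%N)
    (hpeven : ~~ odd p) (alpha : nat -> cplx R)
    (halpha : forall n, `|alpha n| < 1)
    (hper : forall n, alpha (n + p)%N = alpha n)
    (b : nat) (hb : (b < p)%N) :
  (forall z : cplx R, ~ bands alpha p z ->
     prefactor alpha p m z * (phi alpha (m * p + b)).[z] @[m --> \oo]
       --> j_fun alpha p b z)
  /\
  (exists r : cplx R, 0 < r /\
     forall z : cplx R, r < `|z| -> j_fun alpha p b z != 0)
  /\
  (forall z0 : cplx R, ~ bands alpha p z0 -> j_fun alpha p b z0 != 0 ->
     exists eps : cplx R, 0 < eps /\
     exists M : nat, forall (z : cplx R) (m : nat),
       `|z - z0| < eps -> (M <= m)%N -> (phi alpha (m * p + b)).[z] != 0)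
  /\
  (forall (z0 : cplx R) (k : nat), ~ bands alpha p z0 ->
     zero_of_order (j_fun alpha p b) z0 k ->
     exists eps : cplx R, 0 < eps /\
     exists M : nat, forall m : nat, (M <= m)%N ->
       count (fun z => `|z - z0| < eps) (zeros (phi alpha (m * p + b))) = k)
  /\
  ((exists n, alpha n != 0) ->
     [set z0 | ~ bands alpha p z0 /\ j_fun alpha p b z0 = 0]
       #<= `I_(2 * p + 2 * b - 1)).
Proof.
have archi := @cplx_archimedean R.
have p_gt0 : (0 < p)%N by apply: leq_trans hp2.
have split := @off_bands_split _ _ _ halpha p_gt0 hpeven.
split; last split; last split; last split.
- by move=> z /split; apply: cvg_phi_normalized.
- exact: j_fun_infinity.
- by move=> z0 /split; apply: phi_neq0_near.
- by move=> z0 k /split; apply: zeros_phi_order.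
- exact: card_zeros_j_fun.
Qed.
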